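(* Let $D$ be a Drinfeld $A$-module over $\operatorname{Spec}\mathcal{O}_K$. For each element $\lambda\in D(K)\setminus D(\mathcal{O}_K)$ the image of the homomorphism $[\lambda,\ )_{\mathrm{ad}}\colon I_K\to\hat TD$ is open.
   Context: $\mathbb{F}_q$ finite field of characteristic $p$; $K\supset\mathbb{F}_q$ a local field of characteristic $p$ with ring of integers $\mathcal{O}_K$, maximal ideal $\mathfrak{p}_K$; $K^s$, $K^{ur}$, $G_K$, inertia $I_K$. $F$ global function field over $\mathbb{F}_q$, $\infty$ a place, $A$ the ring of elements regular outside $\infty$. $D$: a homomorphism $\varphi\colon A\to\mathcal{O}_K[\tau]$ ($\tau\alpha=\alpha^q\tau$) which is a Drinfeld module over $K$ and whose reduction mod $\mathfrak{p}_K$ has the same rank; $\iota(a)$ = constant coefficient of $\varphi(a)$, residual characteristic $\mathfrak{p}_0=\iota^{-1}(\mathfrak{p}_K)$. $D(L)$ denotes $L$ with $A$-action via $\varphi$; $D(\mathcal{O}_K)=\mathcal{O}_K$. For proper ideals $\mathfrak{n}\subset A$ not contained in $\mathfrak{p}_0$, $D_\mathfrak{n}=\operatorname{Hom}_A(\mathfrak{n}^{-1}/A,D(K^s))$ and $\hat TD=\varprojlim_\mathfrak{n}D_\mathfrak{n}$ (profinite topology). Kummer pairing: for $\lambda\in D(K^{ur})$ choose $A$-linear $f\colon\mathfrak{n}^{-1}\to D(K^s)$ with $f(1)=\lambda$; for $g\in I_K$, $g\circ f-f$ factors through $\mathfrak{n}^{-1}/A$ and gives $[\lambda,g)_\mathfrak{n}\in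 D_\mathfrak{n}$ independent of $f$; the limit over $\mathfrak{n}$ is $[\lambda,g)_{\mathrm{ad}}\in\hat TD$, a homomorphism in $g$. *)

(* Defs.v *)
From HB Require Import structures.
From mathcomp Require Import all_boot all_order all_algebra all_field.
From mathcomp Require Import all_classical all_reals all_analysis.

Set Implicit Arguments.
Unset Strict Implicit.
Unset Printing Implicit Defensive.

Import Order.TTheory GRing.Theory Num.Theory.

Local Open Scope classical_set_scope.
Local Open Scope ring_scope.

(* Normalized discrete valuations.  The value at 0 (mathematically +oo) is set
   to 0 by convention, so that a valuation is determined by its values on
   nonzero elements; every use below treats 0 separately. *)
Record dvaluation (K : fieldType) := DValuation {
  dval :> K -> int;
  dval0 : dval 0 = 0;
  dvalM : forall x y, x != 0 -> y != 0 -> dval (x * y) = dval x + dval y;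
  dvalD : forall x y, x != 0 -> y != 0 -> x + y != 0 ->
    Num.min (dval x) (dval y) <= dval (x + y);
  dval_normalized : exists x, dval x = 1 }.

Section Valuations.
Variables (K : fieldType) (v : dvaluation K).

(* v x >= n, with v 0 = +oo *)
Definition val_ge (n : int) (x : K) : bool := (x == 0) || (n <= v x).

Definition vring : {pred K} := [pred x | val_ge 0 x].
Definition vmax : {pred K} := [pred x | val_ge 1 x].

Definition vcomplete : Prop :=
  forall u : nat -> K,
    (forall n : int, exists N : nat, forall i j : nat,
       (N <= i)%N -> (N <= j)%N -> val_ge n (u i - u j)) ->
  exists l : K, forall n : int, exists N : nat, forall i : nat,
    (N <= i)%N -> val_ge n (u i - l).

Definition finite_residue_field : Prop :=
  exists s : seq K, forall x, x \in vring ->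
    exists2 y, y \in s & x - y \in vmax.

Definition local_field : Prop := vcomplete /\ finite_residue_field.

End Valuations.

Section SeparableClosure.
Variables (K Ks : fieldType) (i : {rmorphism K -> Ks}) (v : dvaluation K).

Definition separable_closure : Prop :=
  (forall y : Ks, exists2 P : {poly K},
     separable_poly P & root (map_poly i P) y) /\
  (forall P : {poly Ks},
     separable_poly P -> (1 < size P)%N -> exists y, root P y).

(* The integral closure of the valuation ring in Ks. *)
Definition int_closure : set Ks := [set y | exists P : {poly K},
  [/\ P \is monic, P \is a polyOver (vring v) & root (map_poly i P) y]].

(* When v is complete, int_closure is a local ring; its maximal ideal is the
   set of its nonunits. *)
Definition int_closure_max : set Ks := [set y | int_closure y /\
  (y = 0 \/ ~ int_closure y^-1)].

Definition galois_group : set {rmorphism Ks -> Ks} :=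
  [set g : {rmorphism Ks -> Ks} | bijective g /\ forall x : K, g (i x) = i x].

Definition inertia_group : set {rmorphism Ks -> Ks} :=
  [set g : {rmorphism Ks -> Ks} | galois_group g /\
     forall y, int_closure y -> int_closure_max (g y - y)].

End SeparableClosure.

(* The ring of elements of F regular outside the place vinf. *)
Section RegularRing.
Variables (F : fieldType) (vinf : dvaluation F).

Definition regular : {pred F} :=
  [pred x | `[< forall w : dvaluation F, w <> vinf -> x \in vring w >]].

Lemma dval1 (w : dvaluation F) : w 1 = 0.
Proof.
have := @dvalM _ w 1 1 (oner_neq0 _) (oner_neq0 _); rewrite mulr1 => h.
by apply: (@addrI _ (w 1)); rewrite -h addr0.
Qed.

Lemma dvalN1 (w : dvaluation F) : w (- 1) = 0.
Proof.
have n1 : (- 1 : F) != 0 by rewrite oppr_eq0 oner_neq0.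
have := @dvalM _ w _ _ n1 n1; rewrite mulrNN mulr1 dval1 => /esym /eqP.
by rewrite -mulr2n mulrn_eq0 /= => /eqP.
Qed.

Lemma vring_mul (w : dvaluation F) x y :
  x \in vring w -> y \in vring w -> x * y \in vring w.
Proof.
rewrite !inE /val_ge mulf_eq0.
have [|x0] := eqVneq x 0; have [|y0] := eqVneq y 0; rewrite ?orbT //=.
by move=> hx hy; rewrite dvalM // addr_ge0.
Qed.

Lemma vring_opp (w : dvaluation F) x : x \in vring w -> - x \in vring w.
Proof.
have n1 : (- 1 : F) \in vring w by rewrite inE /val_ge dvalN1 lexx orbT.
by rewrite -mulN1r; exact: vring_mul.
Qed.

Lemma vring_add (w : dvaluation F) x y :
  x \in vring w -> y \in vring w -> x + y \in vring w.
Proof.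
have [->|x0] := eqVneq x 0; first by rewrite add0r.
have [->|y0] := eqVneq y 0; first by rewrite addr0.
have [s0|s0] := eqVneq (x + y) 0; first by rewrite s0 !inE /val_ge eqxx.
rewrite !inE /val_ge (negbTE x0) (negbTE y0) (negbTE s0) /= => hx hy.
by apply: le_trans (@dvalD _ w _ _ x0 y0 s0); rewrite le_min hx hy.
Qed.

Fact regular_subring_closed : subring_closed regular.
Proof.
split=> [|x y /asboolP hx /asboolP hy|x y /asboolP hx /asboolP hy];
  apply/asboolP => w wi.
- by rewrite inE /val_ge dval1 lexx orbT.
- by apply: vring_add; [exact: hx | apply: vring_opp; exact: hy].
- by apply: vring_mul; [exact: hx | exact: hy].
Qed.
HB.instance Definition _ :=
  GRing.isSubringClosed.Build F regular regular_subring_closed.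

Record regular_ring :=
  RegularRing { regular_val : F; _ : regular_val \in regular }.

HB.instance Definition _ := [isSub for regular_val].
HB.instance Definition _ := [Choice of regular_ring by <:].
HB.instance Definition _ := [SubChoice_isSubComNzRing of regular_ring by <:].

End RegularRing.

(* The additive subgroup I of A has index n. *)
Definition has_index (A : zmodType) (I : set A) (n : nat) : Prop :=
  exists s : n.-tuple A, forall x, exists! k : 'I_n, I (x - tnth s k).

(* The polynomial \sum_i c_i 'X^i stands for the twisted polynomial
   \sum_i c_i tau^i, where tau * c = c ^+ q * tau. *)
Section TwistedPolynomials.
Variables (q : nat) (K : fieldType).

Definition skew_mul (f g : {poly K}) : {poly K} :=
  \sum_(i < size f) \sum_(j < size g)
     (f`_i * g`_j ^+ (q ^ i)) *: 'X^(i + j).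

Definition skew_eval (L : fieldType) (h : {rmorphism K -> L})
    (f : {poly K}) (x : L) : L :=
  \sum_(j < size f) h f`_j * x ^+ (q ^ j).

(* Over a subring of K containing the coefficients of f, in which I is an
   ideal: f modulo I is nonzero of degree d in tau. *)
Definition degree_mod (I : {pred K}) (f : {poly K}) (d : nat) : Prop :=
  f`_d \notin I /\ forall j : nat, (d < j)%N -> f`_j \in I.

End TwistedPolynomials.

Section Drinfeld.
Variables (Fq : finFieldType) (F K : fieldType).
Variables (vinf : dvaluation F) (vK : dvaluation K).
Local Notation q := #|Fq|.
Local Notation A := (regular_ring vinf).

(* phi modulo I has rank r: its degree at each nonzero a is r * deg a,
   where #|A / aA| = q ^ (deg a). *)
Definition has_rank (I : {pred K}) (phi : A -> {poly K}) (r : nat) : Prop :=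
  forall a : A, a != 0 -> exists d : nat,
    has_index (range (fun b => a * b)) (q ^ d) /\
    degree_mod I (phi a) (r * d).

(* A ring homomorphism from A to the twisted polynomials over the valuation ring
   of K.  F_q-linearity is not imposed: the restriction to constants is an
   embedding of F_q, that is, the given one up to a power of Frobenius. *)
Record drinfeld_module := DrinfeldModule {
  dphi :> A -> {poly K};
  dphi_int : forall a, dphi a \is a polyOver (vring vK);
  dphi1 : dphi 1 = 1;
  dphiD : forall a b, dphi (a + b) = dphi a + dphi b;
  dphiM : forall a b, dphi (a * b) = skew_mul q (dphi a) (dphi b);
  dphi_nonconstant : exists a, (1 < size (dphi a))%N;
  dphi_good : exists r : nat,
    has_rank (pred1 0) dphi r /\ has_rank (vmax vK) dphi r }.

Variable D : drinfeld_module.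

Definition residual_char : set A := [set a | (D a)`_0 \in vmax vK].

(* The proper ideals not contained in the residual characteristic; such an
   ideal is nonzero. *)
Record level := Level {
  level_set : set A;
  level0 : level_set 0;
  levelD : forall a b, level_set a -> level_set b -> level_set (a + b);
  levelM : forall a b, level_set b -> level_set (a * b);
  level_proper : level_set <> setT;
  level_not_sub : ~ (level_set `<=` residual_char) }.

(* The fractional ideal n^-1. *)
Definition level_inv (n : level) : set F :=
  [set x | forall a : A, level_set n a -> val a * x \in regular vinf].

Variables (Ks : fieldType) (i : {rmorphism K -> Ks}).

Definition drinfeld_act (a : A) (x : Ks) : Ks := skew_eval q i (D a) x.

(* Hom_A(n^-1, D(Ks)); the additions and multiplications are those of F. *)
Definition linear_maps (n : level) : set (level_inv n -> Ks) :=
  [set f | (forall x y z : level_inv n,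
              val z = val x + val y -> f z = f x + f y) /\
           (forall (a : A) (x z : level_inv n),
              val z = val a * val x -> f z = drinfeld_act a (f x))].

(* Hom_A(n^-1 / A, D(Ks)), as the linear maps on n^-1 which vanish on A. *)
Definition torsion_maps (n : level) : set (level_inv n -> Ks) :=
  [set f | linear_maps f /\
           forall x : level_inv n, val x \in regular vinf -> f x = 0].

Definition torsion (n : level) : Type := set_type (@torsion_maps n).

HB.instance Definition _ (n : level) := Choice.on (torsion n).

(* The limit of the discrete spaces torsion n, along the restriction maps
   torsion n -> torsion m for n contained in m, with the topology induced from
   their product. *)
Definition tate_module :
    set (prod_topology (fun n : level => discrete_topology (torsion n))) :=
  [set t | forall n m : level, level_set n `<=` level_set m ->
     forall (x : level_inv n) (y : level_inv m), val x = val y ->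
       val (t n) x = val (t m) y].

Fact torsion_zero (n : level) : torsion_maps (fun _ : level_inv n => 0).
Proof.
have act0 a : drinfeld_act a 0 = 0.
  apply: big1 => j _; rewrite expr0n expn_eq0 -leqn0 leqNgt.
  by rewrite (ltnW (card_finNzRing_gt1 Fq)) mulr0.
by split=> //; split=> // x y z _; rewrite addr0.
Qed.

Definition torsion0 (n : level) : torsion n := SigSub (mem_set (torsion_zero n)).

Fact tate_zero : tate_module torsion0.
Proof. by []. Qed.

Definition tate0 : tate_module := SigSub (mem_set tate_zero).

(* f is a linear map on n^-1 with f 1 = lam, and h = g \o f - f. *)
Definition kummer_rel (n : level) (lam : Ks) (g : Ks -> Ks) (h : torsion n) :=
  exists f : level_inv n -> Ks,
    [/\ linear_maps f,
        forall x : level_inv n, val x = 1 -> f x = lam &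
        forall x, val h x = g (f x) - f x].

(* The pairing [lam, g)_n: the element related to lam and g by kummer_rel.  It
   exists and is unique when g lies in the inertia group and lam is fixed by
   that group; the default value torsion0 is irrelevant. *)
Definition kummer (n : level) (lam : Ks) (g : Ks -> Ks) : torsion n :=
  xget (torsion0 n) [set h | kummer_rel lam g h].

(* The pairing [lam, g)_ad: the element of the Tate module with components
   [lam, g)_n, for the same lam and g. *)
Definition kummer_ad (lam : Ks) (g : Ks -> Ks) : tate_module :=
  xget tate0 [set t : tate_module | forall n, val t n = kummer n lam g].

End Drinfeld.

(* Main.v *)
(* Let m = - v(lam) > 0.  For c in A prime to the residual characteristic let
   V = D[c], choose x with D_c(x) = lam, and let H be the subgroup of the
   g(x) - x in V, for g in inertia.  By good reduction the product over V of the
   x - h is lam up to a unit, and each x - h has the valuation of x, so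
   v(lam) = #V v(x).  The product z of the x - h over H is fixed by inertia, so
   v(z) = #H v(x) is an integer.  Hence (V : H) <= m, uniformly in c.
   Therefore the index is stationary along multiples of some c0: beyond level c0
   the image contains the whole kernel of the restriction to level c0.  Any
   element of the Tate module which agrees with [lam, g0) at level c0 is then
   realized at every level, and the realizations glue to a single element of
   inertia. *)

From HB Require Import structures.
Require Import Defs.
From mathcomp Require Import all_boot all_order all_algebra all_field.
From mathcomp Require Import all_classical all_reals all_analysis.
From mathcomp Require Import zify ring.

Set Implicit Arguments.
Unset Strict Implicit.
Unset Printing Implicit Defensive.

Import Order.TTheory GRing.Theory Num.Theory.

Local Open Scope classical_set_scope.
Local Open Scope ring_scope.

(** * Extension of automorphisms to the separable closure *)

(** The valuation is never extended to [Ks]. An equality such as v(lam) = #V v(x) becomes an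
    identity up to a unit of the integral closure, and valuations are taken only in [K], whose
    valuation ring is integrally closed. Limits are not taken in [Ks] either, which need not be
    complete, but in O_K[x] for one integral x at a time. Characteristic p supplies the structure of
    inertia. The Teichmueller representatives form a field, the algebraic closure of the prime field
    in [Ks]; inertia consists of the automorphisms fixing this field and [K], and an element fixed
    by inertia lies in their compositum. Nonzero elements of the compositum are, up to units,
    elements of [K]: this is why v(z) is an integer. The index becomes stationary because each
    failure of stability at least doubles it, while it stays bounded. The gluing does not invoke
    compactness of inertia: the realizations at the various levels define a homomorphism on the ring
    of elements on which they agree, and Zorn's lemma extends it to [Ks]. *)

Section ExtendHom.
Variables (K Ks : fieldType) (i : {rmorphism K -> Ks}).
Hypothesis hKs : separable_closure i.

Lemma sep_closed_roots (P : {poly Ks}) : separable_poly P ->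
  exists2 rs, uniq rs & P = lead_coef P *: \prod_(r <- rs) ('X - r%:P).
Proof.
have [n le_n] := ubnP (size P); elim: n P le_n => // n IHn P le_n sP.
have P0 := separable_poly_neq0 sP.
have [sz1|sz1] := leqP (size P) 1.
  exists [::]; rewrite // big_nil {1}(size1_polyC sz1) lead_coefE -alg_polyC.
  by move: sz1 P0; rewrite -size_poly_gt0; case: (size P) => [|[]].
have [y /factor_theorem[Q defP]] := hKs.2 P sP sz1.
move: (sP); rewrite defP separable_root => /andP[sQ yQ].
have Q0 := separable_poly_neq0 sQ.
have szP : size P = (size Q).+1.
  by rewrite defP size_Mmonic ?monicXsubC // size_XsubC addn2.
have [|rs uniq_rs defQ] := IHn Q _ sQ; first by rewrite -ltnS -szP.
exists (y :: rs); last first.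
  rewrite big_cons lead_coef_Mmonic ?monicXsubC // [in LHS]mulrC.
  by rewrite [in LHS]defQ -scalerAr.
rewrite /= uniq_rs andbT; apply: contra yQ => yrs.
by rewrite defQ rootZ ?lead_coef_eq0 // root_prod_XsubC.
Qed.

(** As [x] is nonzero, powers of ['X] can be divided out of an annihilating polynomial. The nonzero
    constant term later makes partial homomorphisms injective and expresses inverses as
    polynomials. *)
Lemma root_nonzero_const (x : Ks) : x != 0 ->
  exists2 P : {poly K}, root (map_poly i P) x & P`_0 != 0.
Proof.
move=> x0; have [P sP rP] := hKs.1 x.
have P0 := separable_poly_neq0 sP.
have [n le_n] := ubnP (size P);
  elim: n {sP} P le_n rP P0 => // n IHn P le_n rP P0.
have [P00|] := eqVneq P`_0 0; last by exists P.
have defP : P = (P %/ 'X) * 'X.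
  apply/esym/divpK; rewrite -(subr0 'X) -polyC0 dvdp_XsubCl.
  by rewrite rootE horner_coef0 P00.
have Q0 : P %/ 'X != 0 by apply: contraNneq P0 => Q0; rewrite defP Q0 mul0r.
apply: (IHn (P %/ 'X)) => //.
  by move: le_n; rewrite {1}defP size_mulX // ltnS; apply: leq_trans.
by move: rP; rewrite {1}defP rmorphM /= map_polyX rootM rootX (negPf x0) orbF.
Qed.

(* Graphs of K-algebra homomorphisms from K-subalgebras of Ks to Ks. *)
Definition partial_hom (R : set (Ks * Ks)) : Prop :=
  [/\ forall k, R (i k, i k),
      forall x x' y y', R (x, x') -> R (y, y') -> R (x - y, x' - y'),
      forall x x' y y', R (x, x') -> R (y, y') -> R (x * y, x' * y') &
      forall x', R (0, x') -> x' = 0].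

Definition poly_rel (R : set (Ks * Ks)) (f f' : {poly Ks}) : Prop :=
  forall j, R (f`_j, f'`_j).

Section PartialHom.
Variable R : set (Ks * Ks).
Hypothesis hR : partial_hom R.

Let RK k : R (i k, i k). Proof. by have [] := hR. Qed.
Let RB x x' y y' : R (x, x') -> R (y, y') -> R (x - y, x' - y').
Proof. by have [_ + _ _] := hR; apply. Qed.
Let RM x x' y y' : R (x, x') -> R (y, y') -> R (x * y, x' * y').
Proof. by have [_ _ + _] := hR; apply. Qed.
Let R_fun x' : R (0, x') -> x' = 0. Proof. by have [_ _ _] := hR; apply. Qed.
Let R0 : R (0, 0). Proof. by have := RK 0; rewrite rmorph0. Qed.
Let R1 : R (1, 1). Proof. by have := RK 1; rewrite rmorph1. Qed.
Let RN x x' : R (x, x') -> R (- x, - x').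
Proof. by move=> /(RB R0); rewrite !sub0r. Qed.
Let RD x x' y y' : R (x, x') -> R (y, y') -> R (x + y, x' + y').
Proof. by move=> h /RN /(RB h); rewrite !opprK. Qed.

Let Rsum n (F F' : 'I_n -> Ks) :
  (forall j, R (F j, F' j)) -> R (\sum_j F j, \sum_j F' j).
Proof. by move=> h; elim/big_ind2: _ => // *; apply: RD. Qed.

Let RX x x' n : R (x, x') -> R (x ^+ n, x' ^+ n).
Proof.
by move=> h; elim: n => [|n IHn]; rewrite ?expr0 // !exprS; apply: RM.
Qed.

Lemma poly_rel_horner f f' x x' : poly_rel R f f' -> R (x, x') ->
  R (f.[x], f'.[x']).
Proof.
move=> rf rx.
rewrite (@horner_coef_wide _ (maxn (size f) (size f'))) ?leq_maxl //.
rewrite (@horner_coef_wide _ (maxn (size f) (size f')) f') ?leq_maxr //.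
by apply: Rsum => j; apply: RM; [apply: rf | apply: RX].
Qed.

Lemma poly_relK P : poly_rel R (map_poly i P) (map_poly i P).
Proof. by move=> j; rewrite coef_map; apply: RK. Qed.

(** The domain of [R] is only a ring, so injectivity comes from algebraicity: if a nonzero [x] were
    sent to 0, the equation P(x) = 0 would become P(0) = 0. *)
Lemma partial_hom_inj x : R (x, 0) -> x = 0.
Proof.
move=> rx; apply/eqP; apply: contraT => /root_nonzero_const[P /rootP rP].
have := poly_rel_horner (poly_relK P) rx; rewrite rP => /R_fun /eqP.
by rewrite horner_coef0 coef_map fmorph_eq0 => /eqP->; rewrite eqxx.
Qed.

Lemma partial_hom_fun x y y' : R (x, y) -> R (x, y') -> y = y'.
Proof.
move=> h h'; have := RB h h'; rewrite subrr => /R_fun/eqP.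
by rewrite subr_eq0 => /eqP.
Qed.

Lemma poly_relM f f' g g' : poly_rel R f f' -> poly_rel R g g' ->
  poly_rel R (f * g) (f' * g').
Proof. by move=> rf rg j; rewrite !coefM; apply: Rsum => k; apply: RM. Qed.

Lemma poly_relB f f' g g' : poly_rel R f f' -> poly_rel R g g' ->
  poly_rel R (f - g) (f' - g').
Proof. by move=> rf rg j; rewrite !coefB; apply: RB. Qed.

Lemma poly_relC c c' : R (c, c') -> poly_rel R c%:P c'%:P.
Proof. by move=> rc j; rewrite !coefC; case: ifP. Qed.

Lemma poly_relXn n : poly_rel R 'X^n 'X^n.
Proof. by move=> j; rewrite !coefXn; case: (_ == _). Qed.

Lemma poly_rel_size f f' : poly_rel R f f' -> size f' = size f.
Proof.
move=> rf; apply/eqP; rewrite eqn_leq; apply/andP; split.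
  apply/leq_sizeP => j sz_j; apply: R_fun.
  by have := rf j; rewrite (nth_default _ sz_j).
apply/leq_sizeP => j sz_j; apply: partial_hom_inj.
by have := rf j; rewrite (nth_default _ sz_j).
Qed.

(* [f] plays the role of the minimal polynomial of [y] over the domain of
   [R], and [f'] that of its conjugate under [R]. *)
Lemma poly_rel_min y : exists f f',
  [/\ poly_rel R f f', root f y, (1 < size f)%N, separable_poly f' &
      forall h h', poly_rel R h h' -> root h y -> f' %| h'].
Proof.
have [P sP rP] := hKs.1 y.
pose good n := `[< exists f f',
  [/\ poly_rel R f f', f != 0, root f y & size f = n] >].
have ex_good : exists n, good n.
  exists (size (map_poly i P)); apply/asboolP.
  exists (map_poly i P), (map_poly i P); split=> //; first exact: poly_relK.
  by rewrite map_poly_eq0 separable_poly_neq0.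
case: (ex_minnP ex_good) => n /asboolP[f [f' [rf f0 ry sz_f]]] min_n.
have f'0 : f' != 0 by rewrite -size_poly_gt0 (poly_rel_size rf) size_poly_gt0.
have f'P h h' : poly_rel R h h' -> root h y -> f' %| h'.
  have [N le_N] := ubnP (size h); elim: N h h' le_N => // N IHN h h' le_N rh hy.
  have [h0|h0] := eqVneq h 0.
    suff -> : h' = 0 by exact: dvdp0.
    by apply/eqP; rewrite -size_poly_eq0 (poly_rel_size rh) h0 size_poly0.
  have le_fh : (size f <= size h)%N.
    by rewrite sz_f; apply: min_n; apply/asboolP; exists h, h'.
  (* Division by [lead_coef f] may leave the domain of [R], so this is a pseudo-division step: the
     leading terms cancel in [g], and [g'] is the conjugate of [g]. *)
  pose d := (size h - size f)%N.
  pose g := (lead_coef f)%:P * h - (lead_coef h)%:P * 'X^d * f.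
  pose g' := (lead_coef f')%:P * h' - (lead_coef h')%:P * 'X^d * f'.
  have rl : forall k k', poly_rel R k k' -> R (lead_coef k, lead_coef k').
    by move=> k k' rk; rewrite !lead_coefE (poly_rel_size rk); apply: rk.
  have rg : poly_rel R g g'.
    apply: poly_relB; apply: poly_relM => //; first exact/poly_relC/rl.
    by apply: poly_relM; [exact/poly_relC/rl | exact: poly_relXn].
  have gy : root g y.
    by rewrite rootE !hornerE (rootP ry) (rootP hy) !mulr0 subrr.
  have lt_g : (size g < size h)%N.
    have hs : (0 < size h)%N by rewrite size_poly_gt0.
    rewrite -(prednK hs) ltnS; apply/leq_sizeP => j le_j.
    rewrite coefB !coefCM -mulrA coefCM coefXnM.
    have fs : (0 < size f)%N by rewrite size_poly_gt0.
    have dE : (d + (size f).-1 = (size h).-1)%N by rewrite /d; lia.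
    case: (ltngtP j (size h).-1) le_j => // [lt_j|->] _.
      rewrite nth_default ?mulr0 ?sub0r; last by rewrite -(prednK hs).
      rewrite ifF; last by apply/negbTE; rewrite -leqNgt /d; lia.
      have le_j : (size f <= j - d)%N by move: hs dE fs lt_j; clear; lia.
      by rewrite (nth_default _ le_j) mulr0 oppr0.
    rewrite -dE ltnNge leq_addr /= addKn -!lead_coefE dE -lead_coefE.
    by rewrite mulrC subrr.
  have : f' %| g' by apply: (IHN g) => //; apply: leq_trans lt_g _.
  move=> /dvdp_add /(_ (dvdp_mull ((lead_coef h')%:P * 'X^d) (dvdpp f'))).
  by rewrite subrK mul_polyC dvdpZr // lead_coef_eq0.
have f'_sep : separable_poly f'.
  apply: dvdp_separable (f'P _ _ (poly_relK P) rP) _.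
  by rewrite separable_map.
exists f, f'; split=> //; rewrite ltnNge; apply/negP => sz1.
move: ry f0; rewrite (size1_polyC sz1) rootC => /eqP->.
by rewrite polyC0 eqxx.
Qed.

(** Sending h(y) to h'(y') is well defined because every relation satisfied by [y] passes to
    [y']. *)
Lemma partial_hom_adjoin y y' :
    (forall h h', poly_rel R h h' -> root h y -> root h' y') ->
  let R' := [set z | exists h h', poly_rel R h h' /\ z = (h.[y], h'.[y'])] in
  [/\ partial_hom R', R `<=` R' & R' (y, y')].
Proof.
move=> rootR R'; split; first split.
- by move=> k; exists (i k)%:P, (i k)%:P; rewrite !hornerC; split=> //;
  apply: poly_relC.
- move=> _ _ _ _ [h [h' [rh [-> ->]]]] [g [g' [rg [-> ->]]]].
  by exists (h - g), (h' - g'); rewrite !hornerE; split=> //; apply: poly_relB.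
- move=> _ _ _ _ [h [h' [rh [-> ->]]]] [g [g' [rg [-> ->]]]].
  by exists (h * g), (h' * g'); rewrite !hornerE; split=> //; apply: poly_relM.
- move=> _ [h [h' [rh [h0 ->]]]]; apply/rootP; apply: rootR rh _.
  by apply/rootP.
- move=> [x x'] rx; exists x%:P, x'%:P; rewrite !hornerC; split=> //.
  exact: poly_relC.
- by exists 'X, 'X; rewrite !hornerX; split=> //; apply: (poly_relXn 1).
Qed.

End PartialHom.

(** An injective endomorphism over [K] permutes the finitely many roots of each polynomial over [K],
    hence is surjective. *)
Lemma galois_bijective (g : {rmorphism Ks -> Ks}) :
  (forall k, g (i k) = i k) -> galois_group i g.
Proof.
move=> gK; split=> //; suff g_surj y : exists x, g x = y.
  have [h hP] := choice g_surj; exists h => // x.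
  by apply: (fmorph_inj g); rewrite hP.
have [P sP rP] := hKs.1 y.
have P0 : map_poly i P != 0 by rewrite map_poly_eq0 separable_poly_neq0.
have [rs uniq_rs defP] : exists2 rs, uniq rs &
    map_poly i P = lead_coef (map_poly i P) *: \prod_(r <- rs) ('X - r%:P).
  by apply: sep_closed_roots; rewrite separable_map.
have rsP x : root (map_poly i P) x = (x \in rs).
  by rewrite defP rootZ ?lead_coef_eq0 // root_prod_XsubC.
have sub_rs : {subset map g rs <= rs}.
  move=> _ /mapP[x + ->]; rewrite -!rsP -(fmorph_root g) -map_poly_comp.
  by rewrite (eq_map_poly (g := i)).
have uniq_grs : uniq (map g rs).
  by rewrite map_inj_uniq //; apply: fmorph_inj.
have [|_ eq_rs] := uniq_min_size uniq_grs sub_rs; first by rewrite size_map.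
move: rP; rewrite rsP -eq_rs.
by case/mapP => x _ ->; exists x.
Qed.

(** A maximal extension is defined everywhere: the conjugate of the minimal polynomial of [y] is
    separable, so it has a root in [Ks] to which [y] can be sent. *)
Lemma partial_hom_extend (R : set (Ks * Ks)) : partial_hom R ->
  exists g : {rmorphism Ks -> Ks},
    galois_group i g /\ forall x x', R (x, x') -> g x = x'.
Proof.
move=> hR.
pose P (S : set (Ks * Ks)) := S = set0 \/ partial_hom S /\ R `<=` S.
have [F FP totF|M [[M0|[hM RM]] maxM]] := @Zorn_bigcup _ P; last 1 first.
- have [_ M_B M_M M_fun] := hM.
  have Mtot y : exists y', M (y, y').
    have [f [f' [rf fy sz_f sf' f'P]]] := poly_rel_min hM y.
    have [|y' f'y'] := hKs.2 f' sf'; first by rewrite (poly_rel_size hM rf).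
    have [h h' rh hy|hM' MM' M'y] := @partial_hom_adjoin M hM y y'.
      exact: (root_dvdp (f'P _ _ rh hy)).
    set M' := (X in partial_hom X) in hM' MM' M'y.
    exists y'; apply: contrapT => nM; apply: (maxM M').
      by split=> // /(_ _ M'y).
    by right; split=> //; apply: subset_trans MM'.
  have [g gM] := choice Mtot.
  have gE x x' : M (x, x') -> g x = x'.
    by move=> Mx; apply: (partial_hom_fun hM (gM x) Mx).
  have gB : zmod_morphism g by move=> x y; apply/gE/M_B.
  have g1 : monoid_morphism g.
    split=> [|x y]; last exact/gE/M_M.
    by apply: gE; rewrite -(rmorph1 i); have [] := hM.
  pose gZ := GRing.isZmodMorphism.Build _ _ g gB.
  pose gM1 := GRing.isMonoidMorphism.Build _ _ g g1.
  pose gR : {rmorphism Ks -> Ks} := HB.pack g gZ gM1.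
  exists gR; split; last by move=> x x' /RM /gE.
  by apply: galois_bijective => k; apply: gE; have [] := hM.
- have [[S [FS /set0P S0]]|noS] := pselect (exists S, F S /\ S !=set0);
  last first.
    left; rewrite -subset0 => x [S FS Sx]; apply: noS.
    by exists S; split=> //; exists x.
  right.
  have good S' : F S' -> S' !=set0 -> partial_hom S' /\ R `<=` S'.
    by move=> /FP[->|] // [].
  have S0' : S !=set0 by apply/set0P.
  have [hS RS] := good S FS S0'.
  have two x y : (\bigcup_(X in F) X) x -> (\bigcup_(X in F) X) y ->
      exists2 X, F X /\ partial_hom X & X x /\ X y.
    move=> [X FX Xx] [Y FY Yy].
    have [XY|YX] := totF _ _ FX FY.
      exists Y; last by split=> //; apply: XY.
      by split=> //; apply: (good Y FY _).1; exists y.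
    exists X; last by split=> //; apply: YX.
    by split=> //; apply: (good X FX _).1; exists x.
  split; last by move=> x /RS Sx; exists S.
  split.
  + by move=> k; exists S => //; have [] := hS.
  + move=> x x' y y' Hx Hy; have [X [FX [_ XB _ _]] [Xx Xy]] := two _ _ Hx Hy.
    by exists X => //; apply: XB.
  + move=> x x' y y' Hx Hy; have [X [FX [_ _ XM _]] [Xx Xy]] := two _ _ Hx Hy.
    by exists X => //; apply: XM.
  + move=> x' Hx; have [X [FX [_ _ _ Xf]] [Xx _]] := two _ _ Hx Hx.
    exact: Xf.
- exfalso; apply: (maxM R); last by right; split.
  rewrite M0; split=> //; have [RK _ _ _] := hR.
  by move=> /(_ _ (RK 0)).
Qed.

End ExtendHom.

(** * Complete discrete valuations *)

Section Valuation.
Variables (K : fieldType) (v : dvaluation K).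

Lemma dvalV (x : K) : v x^-1 = - v x.
Proof.
have [->|x0] := eqVneq x 0; first by rewrite invr0 dval0 oppr0.
apply: (addrI (v x)); rewrite subrr -dvalM ?invr_eq0 // divff //; exact: dval1.
Qed.

Lemma dvalX (x : K) n : v (x ^+ n) = v x *+ n.
Proof.
have [->|x0] := eqVneq x 0.
  by case: n => [|n]; rewrite ?expr0 ?dval1 // expr0n /= !dval0 mul0rn.
elim: n => [|n IHn]; first by rewrite expr0 dval1.
by rewrite exprS dvalM ?expf_neq0 // IHn mulrS.
Qed.

Fact vring_subring_closed : subring_closed (vring v).
Proof.
split=> [|x y hx hy|x y]; last exact: vring_mul.
  by rewrite inE /val_ge dval1 lexx orbT.
by apply: vring_add => //; apply: vring_opp.
Qed.
HB.instance Definition _ :=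
  GRing.isSubringClosed.Build K (vring v) vring_subring_closed.

Record vring_type := VringType { vring_val : K; _ : vring_val \in vring v }.

HB.instance Definition _ := [isSub for vring_val].
HB.instance Definition _ := [Choice of vring_type by <:].
HB.instance Definition _ := [SubChoice_isSubComNzRing of vring_type by <:].

Variable pi : K.
Hypothesis v_pi : v pi = 1.

Lemma unif_neq0 : pi != 0.
Proof. by apply/eqP => pi0; move: v_pi; rewrite pi0 dval0. Qed.

Lemma unif_vring : pi \in vring v.
Proof. by rewrite inE /val_ge v_pi orbT. Qed.

Lemma val_geP (n : nat) x : reflect (exists2 e, e \in vring v & x = pi ^+ n * e)
  (val_ge v n x).
Proof.
have pn0 : pi ^+ n != 0 by rewrite expf_neq0 // unif_neq0.
apply: (iffP idP) => [hx|[e he ->]].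
  exists (x / pi ^+ n); last by rewrite mulrC divfK.
  have [->|x0] := eqVneq x 0; first by rewrite mul0r rpred0.
  move: hx; rewrite inE /val_ge (negPf x0) /= => hx.
  rewrite dvalM ?invr_eq0 // dvalV dvalX v_pi subr_ge0.
  by rewrite natz hx orbT.
have [->|e0] := eqVneq e 0; first by rewrite mulr0 /val_ge eqxx.
move: he; rewrite inE /val_ge (negPf e0) /= => he.
by rewrite dvalM // dvalX v_pi natz lerDl he orbT.
Qed.

Lemma vmaxP x : reflect (exists2 e, e \in vring v & x = pi * e) (x \in vmax v).
Proof. by rewrite inE; apply: (val_geP 1). Qed.

Lemma invr_unif_vring : pi^-1 \notin vring v.
Proof. by rewrite inE /val_ge invr_eq0 (negPf unif_neq0) dvalV v_pi. Qed.

Lemma vring_unit x : x \in vring v -> x \notin vmax v ->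
  x != 0 /\ x^-1 \in vring v.
Proof.
rewrite !inE /val_ge; have [//|x0 /= v0] := eqVneq x 0.
by rewrite -ltNge -[1]add0r ltzD1 invr_eq0 (negPf x0) dvalV oppr_ge0.
Qed.

Lemma dval_unit x : x != 0 -> x \in vring v -> x^-1 \in vring v -> v x = 0.
Proof.
move=> x0; rewrite !inE /val_ge invr_eq0 (negPf x0) dvalV oppr_ge0 /= => h1 h2.
by apply/eqP; rewrite eq_le h1 h2.
Qed.

Hypothesis v_complete : vcomplete v.

(** The partial sums are Cauchy. An exact remainder divisible by [pi ^+ n], rather than a limit, can
    be carried through polynomial evaluation in an extension. *)
Lemma vring_series (d : nat -> K) : (forall k, d k \in vring v) ->
  exists2 c, c \in vring v & forall n, exists2 e, e \in vring v &
    c = \sum_(k < n) pi ^+ k * d k + pi ^+ n * e.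
Proof.
move=> hd; pose u n := \sum_(k < n) pi ^+ k * d k.
have hu N j : (N <= j)%N -> val_ge v N (u j - u N).
  move=> /subnK <-; elim: (j - N)%N => [|m /val_geP[e he IHm]].
    by rewrite add0n subrr /val_ge eqxx.
  apply/val_geP; exists (e + pi ^+ m * d (m + N)%N).
    by rewrite rpredD // rpredM // rpredX // unif_vring.
  rewrite mulrDr -IHm /u addSn big_ord_recr /= mulrA -exprD [(N + m)%N]addnC.
  by rewrite addrAC.
have hB (n : nat) x y : val_ge v n x -> val_ge v n y -> val_ge v n (x - y).
  move=> /val_geP[e he ->] /val_geP[f hf ->]; apply/val_geP.
  by exists (e - f); rewrite ?rpredB // mulrBr.
have [n|l hl] := v_complete (u := u).
  exists `|n|%N => j k hj hk.
  have : val_ge v `|n|%N (u j - u k).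
    have -> : u j - u k = (u j - u `|n|%N) - (u k - u `|n|%N).
      by rewrite opprB addrA subrK.
    by apply: hB; apply: hu.
  by rewrite /val_ge => /orP[->//|h]; rewrite (le_trans _ h) ?orbT // ler_norm.
have key n : exists2 e, e \in vring v & l = u n + pi ^+ n * e.
  have [M hM] := hl n.
  have h1 := hM (maxn M n) (leq_maxl _ _).
  have h2 := hu n (maxn M n) (leq_maxr _ _).
  have /val_geP[e he E] := hB _ _ _ h2 h1.
  exists e => //; rewrite -E; move: (u (maxn _ _)) => w.
  by ring.
exists l => //; have [e he ->] := key 0.
by rewrite /u big_ord0 expr0 mul1r add0r.
Qed.

End Valuation.

(** * The integral closure of the valuation ring *)

Section IntegralClosure.
Variables (K : fieldType) (v : dvaluation K) (pi : K).
Hypothesis v_pi : v pi = 1.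
Variables (Ks : fieldType) (i : {rmorphism K -> Ks}).
Hypothesis Ks_alg : forall y : Ks, algebraicOver i y.

Local Notation O := (int_closure i v).
Local Notation VR := (vring_type v).
Local Notation j := (i \o (val : VR -> K)).

Lemma int_closureE y : O y <-> integralOver j y.
Proof.
split=> [[P [Pm PV Py]]|[P Pm Py]].
  have [Q defQ] : exists Q : {poly VR}, map_poly val Q = P.
    exists (\poly_(k < size P) insubd (0 : VR) P`_k); apply/polyP => k.
    rewrite coef_map coef_poly; case: ltnP => [_|h];
      last by rewrite nth_default.
    by rewrite /= insubdK //; apply/polyOverP.
  exists Q; last by rewrite map_poly_comp defQ.
  move: Pm; rewrite -defQ !monicE lead_coef_map_inj ?rmorph0 //.

exists (map_poly val P); split; last by rewrite -map_poly_comp.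
  exact: monic_map.
by apply/polyOverP => k; rewrite coef_map; apply: valP.
Qed.

Lemma int_closureB x y : O x -> O y -> O (x - y).
Proof. by rewrite !int_closureE; apply: integral_sub. Qed.

Lemma int_closureD x y : O x -> O y -> O (x + y).
Proof. by rewrite !int_closureE; apply: integral_add. Qed.

Lemma int_closureM x y : O x -> O y -> O (x * y).
Proof. by rewrite !int_closureE; apply: integral_mul. Qed.

Lemma int_closureK x : x \in vring v -> O (i x).
Proof.
move=> hx; apply/int_closureE.
by rewrite -[i x]/(j (Sub x hx : VR)); apply: integral_id.
Qed.

Lemma int_closure1 : O 1.
Proof. by rewrite -(rmorph1 i); apply/int_closureK/rpred1. Qed.

Lemma int_closure0 : O 0.
Proof. by rewrite -(rmorph0 i); apply/int_closureK/rpred0. Qed.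

Lemma int_closureN x : O x -> O (- x).
Proof. by rewrite -sub0r; apply: int_closureB; apply: int_closure0. Qed.

Lemma int_closureX x n : O x -> O (x ^+ n).
Proof.
move=> hx; elim: n => [|n IHn]; first by rewrite expr0; apply: int_closure1.
by rewrite exprS; apply: int_closureM.
Qed.

Lemma int_closure_poly (h : {poly VR}) x : O x -> O (map_poly j h).[x].
Proof.
move=> /int_closureE hx; apply/int_closureE; apply: integral_horner => //.
by apply/integral_poly => k; rewrite coef_map; apply: integral_id.
Qed.

Lemma int_closure_root (h : {poly Ks}) x : h \is monic -> root h x ->
  (forall k, O h`_k) -> O x.
Proof.
move=> hm hx hO; apply/int_closureE; apply: integral_root_monic hm hx _.
by apply/integral_poly => k; apply/int_closureE.
Qed.

(** If v(x) < 0, dividing P(x) = 0 by the leading power of [x] writes 1 as a sum of elements of the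
    maximal ideal. *)
Lemma int_closure_vring x : O (i x) -> x \in vring v.
Proof.
move=> [P [Pm PV]]; rewrite fmorph_root => /rootP Px.
have [//|x0] := eqVneq x 0; first by move=> ->; apply: rpred0.
apply: contraT; rewrite inE /val_ge (negPf x0) /= -ltNge => vx.
have P0 : (0 < size P)%N by rewrite size_poly_gt0 monic_neq0.
have xm : x^-1 \in vmax v.
  by rewrite inE /val_ge dvalV invr_eq0 (negPf x0) /= -gtz0_ge1 oppr_gt0.
have [e he xE] := vmaxP v_pi _ xm.
suff : 1 \in vmax v by rewrite inE /val_ge dval1 oner_eq0.
move: Px; rewrite horner_coef -(prednK P0) big_ord_recr /=.
rewrite -lead_coefE (monicP Pm) mul1r => /(congr1 ( *%R^~ (x ^- (size P).-1))).
rewrite /= mul0r mulrDl divff ?expf_neq0 // => /eqP; rewrite addrC addr_eq0.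
move=> /eqP ->; apply/(vmaxP v_pi).
rewrite mulr_suml -sumrN.
exists (\sum_(k < (size P).-1) - (P`_k * e * x^-1 ^+ ((size P).-1 - k).-1)).
  apply: rpred_sum => k _; rewrite rpredN rpredM ?rpredX //.
    by rewrite rpredM //; apply/polyOverP.
  by rewrite xE rpredM // unif_vring.
rewrite mulr_sumr; apply: eq_bigr => k _; rewrite mulrN; congr (- _).
have -> : x ^- (size P).-1 = x^-1 ^+ k * x^-1 * x^-1 ^+ ((size P).-1 - k).-1.
  rewrite -[x ^- _]exprVn -exprSr -exprD; congr (_ ^+ _).
  by have := ltn_ord k; move: (size P).-1 (k : nat) => N l; lia.
rewrite !mulrA -[P`_k * _ * _]mulrA -exprMn divff // expr1n mulr1 {1}xE.
by rewrite mulrA [P`_k * _]mulrC.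
Qed.

Lemma int_closure_invr_unif : ~ O (i pi)^-1.
Proof.
by rewrite -fmorphV => /int_closure_vring; apply/negP/invr_unif_vring.
Qed.

Lemma int_closure_scale u : exists n, O (i pi ^+ n * u).
Proof.
have [P Pm Pu] := (integral_algebraic i u).1 (Ks_alg u).
have P0 : (0 < size P)%N by rewrite size_poly_gt0 monic_neq0.
set N := (size P).-1; have szP : size P = N.+1 by rewrite /N prednK.
(* A crude exponent for which [pi ^+ c] clears the denominators of all lower coefficients of [P]. *)
pose c := (\sum_(k < N) absz (v (P`_k)%R))%N.
have hc k : (k < N)%N -> pi ^+ c * P`_k \in vring v.
  move=> hk; have [->|Pk0] := eqVneq P`_k 0; first by rewrite mulr0 rpred0.
  rewrite inE /val_ge dvalM ?expf_neq0 ?(unif_neq0 v_pi) // dvalX v_pi natz.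
  have : (absz (v (P`_k)%R) <= c)%N
    by rewrite /c (bigD1 (Ordinal hk)) //= leq_addr.
  by rewrite orbC; lia.
exists c.
(* This is [P] with its roots scaled by pi^c; each coefficient below the top one gains at least a
   factor pi^c. *)
pose Q := \poly_(k < N.+1) (P`_k * pi ^+ (c * (N - k))).
have QN : Q`_N = 1.
  by rewrite coef_poly ltnSn subnn muln0 expr0 mulr1 -lead_coefE (monicP Pm).
have szQ : size Q = N.+1.
  by apply: size_poly_eq;
    rewrite subnn muln0 expr0 mulr1 -lead_coefE (monicP Pm) oner_neq0.
exists Q; split.
- by rewrite monicE lead_coefE szQ QN.
- apply/polyOverP => k; rewrite coef_poly; case: ltnP => [hk|_];
  last exact: rpred0.
  have [->|kN] := eqVneq k N.
    by rewrite subnn muln0 expr0 mulr1 -lead_coefE (monicP Pm) rpred1.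
  have -> : (c * (N - k) = c + c * (N - k).-1)%N by move: kN hk; nia.
  rewrite exprD mulrA [P`_k * _]mulrC; apply: rpredM.
    by apply: hc; move: kN hk; lia.
  by rewrite rpredX // (unif_vring v_pi).
apply/rootP; move/rootP: Pu.
rewrite !horner_coef !size_map_poly szQ szP =>
  /(congr1 ( *%R (i pi ^+ (c * N)))).
rewrite mulr0 mulr_sumr => E; rewrite -[RHS]E; apply: eq_bigr => k _.
rewrite !coef_map coef_poly ltn_ord /= rmorphM rmorphXn /= exprMn -exprM.
have -> : (c * N = c * (N - k) + c * k)%N.
  by rewrite -mulnDr subnK // -ltnS ltn_ord.
by rewrite exprD; ring.
Qed.

(** For nonzero [w] some pi^n / w is integral; multiplied by w / pi^(n+1) it would make 1 / pi
    integral. Equalities in [Ks] are proved by approximation through this lemma. *)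
Lemma int_closure_separated w : (forall n, O (w / i pi ^+ n)) -> w = 0.
Proof.
move=> hw; apply/eqP; apply: contraT => w0.
have [n hn] := int_closure_scale w^-1; exfalso; apply: int_closure_invr_unif.
have := int_closureM hn (hw n.+1); congr (O _).
have p0 : i pi != 0 by rewrite fmorph_eq0 (unif_neq0 v_pi).
have pn0 : i pi ^+ n != 0 by rewrite expf_neq0.
by rewrite exprS; field; rewrite w0 p0 pn0.
Qed.

Hypothesis v_complete : vcomplete v.

Definition adjoin_vring (x y : Ks) := exists h : {poly VR}, y = (map_poly j
  h).[x].

Lemma adjoin_vring_int x y : O x -> adjoin_vring x y -> O y.
Proof. by move=> hx [h ->]; apply: int_closure_poly. Qed.

(* The elements of O_K[x] can be written with polynomials of bounded degree in
   [x], so O_K[x] inherits completeness coefficientwise. *)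
Lemma adjoin_vring_series x (g : nat -> Ks) : O x ->
    (forall k, adjoin_vring x (g k)) ->
  exists2 t, adjoin_vring x t & forall n, exists2 e, adjoin_vring x e &
    t = \sum_(k < n) i pi ^+ k * g k + i pi ^+ n * e.
Proof.
move=> /int_closureE[P Pm /rootP Px] hg.
have /choice[h hE] : forall k, exists h : {poly VR},
    (size h < size P)%N /\ g k = (map_poly j h).[x].
  move=> k; have [h ->] := hg k; exists (Pdiv.Ring.rmodp h P); split.
    by rewrite Pdiv.Ring.ltn_rmodpN0 // monic_neq0.
  by rewrite {1}(Pdiv.RingMonic.rdivp_eq Pm h) rmorphD rmorphM /= !hornerE Px
    mulr0 add0r.
have /choice[c cE] : forall l, exists c : VR, forall n, exists e : VR,
    val c = \sum_(k < n) pi ^+ k * val (h k)`_l + pi ^+ n * val e.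
  move=> l.
  have [|c hc cE] := vring_series v_pi v_complete (d := fun k => val (h k)`_l).
    by move=> k; apply: valP.
  exists (Sub c hc) => n; have [e he E] := cE n; exists (Sub e he).
  by rewrite !SubK.
pose N := size P.
exists (map_poly j (\poly_(l < N) c l)).[x];
  first by exists (\poly_(l < N) c l).
move=> n; have [e eE] := choice (fun l => cE l n).
exists (map_poly j (\poly_(l < N) e l)).[x];
  first by exists (\poly_(l < N) e l).
have evE (f : nat -> VR) :
    (map_poly j (\poly_(l < N) f l)).[x] = \sum_(l < N) i (val (f l)) * x ^+ l.
  rewrite (@horner_coef_wide _ N); last first.
    by apply: leq_trans (size_poly _ _) _; apply: size_poly.
  by apply: eq_bigr => l _; rewrite coef_map coef_poly ltn_ord.
rewrite !evE mulr_sumr.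
have -> : \sum_(k < n) i pi ^+ k * g k =
    \sum_(l < N) \sum_(k < n) i pi ^+ k * (i (val (h k)`_l) * x ^+ l).
  rewrite exchange_big /=; apply: eq_bigr => k _; rewrite -mulr_sumr (hE k).2.
  congr (_ * _); rewrite (@horner_coef_wide _ N); last first.
    by apply: leq_trans (size_poly _ _) (ltnW (hE k).1).
  by apply: eq_bigr => l _; rewrite coef_map.
rewrite -big_split /=; apply: eq_bigr => l _;
  rewrite eE rmorphD rmorphM rmorphXn /=.
rewrite mulrDl -mulrA; congr (_ + _); rewrite rmorph_sum mulr_suml.
by apply: eq_bigr => k _; rewrite rmorphM rmorphXn /= mulrA.
Qed.

(** The inverse is the geometric series in - pi w, summed in O_K[w], which is complete. *)
Lemma one_add_unif_unit w : O w ->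
  1 + i pi * w != 0 /\ O (1 + i pi * w)^-1.
Proof.
move=> hw; have hg k : adjoin_vring w ((- w) ^+ k).
  exists ((- 'X) ^+ k).
  have -> : map_poly j ((- 'X) ^+ k) = (- 'X) ^+ k.
    have jX : map_poly j 'X = 'X by apply: map_polyX.
    by rewrite rmorphXn rmorphN; congr ((- _) ^+ k).
  by rewrite horner_exp hornerN hornerX.
have [t ht tE] := adjoin_vring_series hw hg.
have tO := adjoin_vring_int hw ht.
have key : (1 + i pi * w) * t = 1.
  apply/eqP; rewrite -subr_eq0; apply/eqP/int_closure_separated => n.
  have [e he ->] := tE n; have eO := adjoin_vring_int hw he.
  have -> : \sum_(k < n) i pi ^+ k * (- w) ^+ k = \sum_(k < n) (- (i pi * w))
    ^+ k.
    by apply: eq_bigr => k _; rewrite -mulrN exprMn.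
  set b := i pi * w; set s := \sum_(k < n) _.
  have sE : (1 + b) * s = 1 - (- b) ^+ n.
    by have := subrX1 (- b) n; rewrite -/s => /(congr1 -%R);
      rewrite opprB => ->; ring.
  have -> : ((1 + b) * (s + i pi ^+ n * e) - 1) / i pi ^+ n = (1 + b) * e - (-
    w) ^+ n.
    rewrite mulrDr sE /b -mulrN exprMn.
    have pn0 : i pi ^+ n != 0
      by rewrite expf_neq0 // fmorph_eq0 (unif_neq0 v_pi).
    by field.
  apply: int_closureB; last by apply/int_closureX/int_closureN.
  apply: int_closureM => //; apply: int_closureD; first exact: int_closure1.
  by apply: int_closureM => //; apply/int_closureK/unif_vring.
have u0 : 1 + i pi * w != 0.
  by apply: contra_eq_neq key => ->; rewrite mul0r eq_sym oner_neq0.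
suff <- : t = (1 + i pi * w)^-1 by [].
by apply: (mulfI u0); rewrite key divff.
Qed.

End IntegralClosure.

(** * Reduction and inertia *)

Section ResidueField.
Variables (K : fieldType) (v : dvaluation K) (pi : K).
Hypothesis v_pi : v pi = 1.
Hypotheses (v_complete : vcomplete v) (v_finite : finite_residue_field v).
Variables (Ks : fieldType) (i : {rmorphism K -> Ks}).
Hypothesis Ks_alg : forall y : Ks, algebraicOver i y.
Variable p : nat.
Hypothesis p_char : p \in [pchar Ks].

Local Notation O := (int_closure i v).
Local Notation VR := (vring_type v).
Local Notation j := (i \o (val : VR -> K)).

Let p_gt1 : (1 < p)%N. Proof. exact/prime_gt1/(pcharf_prime p_char). Qed.

Let pnat_pX k : [pchar Ks].-nat (p ^ k)%N.
Proof. by rewrite pnatX pnatE ?(pcharf_prime p_char) // p_char. Qed.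

Lemma exprDpX (x y : Ks) k : (x + y) ^+ (p ^ k) = x ^+ (p ^ k) + y ^+ (p ^ k).
Proof. exact: exprDn_pchar. Qed.

Lemma exprNpX (x : Ks) k : (- x) ^+ (p ^ k) = - x ^+ (p ^ k).
Proof.
apply/eqP; rewrite -addr_eq0 -exprDpX addNr expr0n expn_eq0.
by rewrite (gtn_eqF (ltnW p_gt1)).
Qed.

Lemma exprBpX (x y : Ks) k : (x - y) ^+ (p ^ k) = x ^+ (p ^ k) - y ^+ (p ^ k).
Proof. by rewrite exprDpX exprNpX. Qed.

(* As Ks has characteristic p, these are the elements of the algebraic closure
   of the prime field; they serve as Teichmueller representatives. *)
Definition frob_periodic (t : Ks) := exists2 n, (0 < n)%N & t ^+ (p ^ n) = t.

(* Among the powers x^(p^k) two are congruent modulo pi in O_K[x], say u and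
   u^Q with Q a power of p; then the u^(Q^n) converge to an element t with
   t^Q = t. *)
Lemma frob_periodic_lift x : O x -> exists t k,
  [/\ O t, frob_periodic t & O ((x - t) ^+ (p ^ k) / i pi)].
Proof.
move=> hx; have [P Pm /rootP Px] := (int_closureE v i x).1 hx.
have p0 : i pi != 0 by rewrite fmorph_eq0 (unif_neq0 v_pi).
have [s hs] := v_finite.
have /choice[rep repP] : forall c : VR, exists y : seq_sub s,
    val c - val y \in vmax v.
  move=> c; have [y ys hy] := hs _ (valP c).
  by exists (SeqSub ys).
set N := size P.
(* Each x^(p^k) is the value at [x] of a remainder of bounded size, whose coefficients have finitely
   many residues; by pigeonhole two of these powers agree modulo [pi]. *)
pose r k := Pdiv.Ring.rmodp ('X^(p ^ k)) P : {poly VR}.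
have rE k : (map_poly j (r k)).[x] = x ^+ (p ^ k).
  have := Pdiv.RingMonic.rdivp_eq Pm 'X^(p ^ k).
  move=> /(congr1 (fun h => (map_poly j h).[x])).
  rewrite rmorphD hornerD rmorphM hornerM Px mulr0 add0r => <-.
  have -> : map_poly j 'X^(p ^ k) = 'X^(p ^ k) by apply: map_polyXn.
  by rewrite hornerXn.
have sz_r k : (size (r k) < N)%N by rewrite Pdiv.Ring.ltn_rmodpN0 // monic_neq0.
pose T : finType := {ffun 'I_N -> seq_sub s}.
pose F (k : 'I_#|T|.+1) : T := [ffun l : 'I_N => rep (r k)`_l].
have [a [b [ab Fab]]] : exists a b : nat, (a < b)%N /\
    forall l : 'I_N, rep (r a)`_l = rep (r b)`_l.
  have /injectivePn[a [b ab Fab]] : ~~ injectiveb F.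
    apply/negP => /injectiveP /leq_card; rewrite card_ord.
    by rewrite ltnn.
  have Fl (l : 'I_N) : rep (r a)`_l = rep (r b)`_l.
    by move/ffunP: Fab => /(_ l); rewrite !ffunE.
  case: (ltngtP a b) => [lt|lt|/val_inj eq]; last by rewrite eq eqxx in ab.
    by exists a, b.
  by exists b, a; split.
have [D hD] : exists D : {poly VR},
    x ^+ (p ^ b) - x ^+ (p ^ a) = i pi * (map_poly j D).[x].
  have /choice[d dE] : forall l, exists d : VR,
      (l < N)%N -> val (r b)`_l - val (r a)`_l = pi * val d.
    move=> l; case: (ltnP l N) => [lN|]; last by exists 0.
    have Fl := Fab (Ordinal lN).
    have h1 := repP (r b)`_l; have h2 := repP (r a)`_l; rewrite Fl in h2.
    have /(vmaxP v_pi)[e1 he1 E1] := h1; have /(vmaxP v_pi)[e2 he2 E2] := h2.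
    exists (Sub (e1 - e2) (rpredB he1 he2)) => _; rewrite SubK mulrBr -E1 -E2.
    by rewrite opprB addrA subrK.
  exists (\poly_(l < N) d l); rewrite -!rE.
  rewrite !(@horner_coef_wide _ N); last 3 first.
  - by apply: leq_trans (size_poly _ _) _; apply: size_poly.
  - by apply: leq_trans (size_poly _ _) (ltnW (sz_r _)).
  - by apply: leq_trans (size_poly _ _) (ltnW (sz_r _)).
  rewrite mulr_sumr -sumrB; apply: eq_bigr => l _.
  rewrite !coef_map coef_poly ltn_ord /= mulrA -rmorphM -dE // rmorphB.
  by rewrite mulrBl.
set u := x ^+ (p ^ a); set Q := (p ^ (b - a))%N.
have Q_gt1 : (1 < Q)%N by rewrite /Q -(exp1n (b - a)) ltn_exp2r ?subn_gt0.
have uQ : u ^+ Q - u = i pi * (map_poly j D).[x].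
  by rewrite -hD /u -exprM -expnD subnKC // ltnW.
have QX n : exists m, (Q ^ n)%N = (p ^ m)%N by exists ((b - a) * n)%N;
  rewrite expnM.
have le_nQ n : (n <= Q ^ n)%N by apply/ltnW/ltn_expl.
(* By additivity of Frobenius, u^(Q^(k+1)) - u^(Q^k) is the Q^k-th power of u^Q - u, hence divisible
   by pi^(Q^k). Only pi^k is split off, as the series lemma requires. *)
pose g k := i pi ^+ (Q ^ k - k) * (map_poly j D).[x] ^+ (Q ^ k).
have gE k : u ^+ (Q ^ k.+1) - u ^+ (Q ^ k) = i pi ^+ k * g k.
  rewrite /g mulrA -exprD subnKC // -exprMn -uQ expnS exprM.
  by have [m ->] := QX k; rewrite exprBpX.
have pk k (h : {poly VR}) : exists h' : {poly VR},
    i pi ^+ k * (map_poly j h).[x] = (map_poly j h').[x].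
  have pV := unif_vring v_pi.
  exists ((Sub pi pV : VR) ^+ k *: h).
  rewrite map_polyZ hornerZ; congr (_ * _).
  by rewrite -[i pi]/(j (Sub pi pV)); symmetry; apply: rmorphXn.
have hg k : adjoin_vring v i x (g k).
  have [h' E] := pk (Q ^ k - k)%N (D ^+ (Q ^ k)); exists h'.
  rewrite -E /g -horner_exp; congr (_ * _.[x]).
  by symmetry; apply: rmorphXn.
have [t0 ht0 t0E] := adjoin_vring_series v_pi v_complete hx hg.
set t := t0 + u.
have uO : O u by apply: int_closureX.
have tO : O t by apply: int_closureD => //; apply: adjoin_vring_int hx ht0.
have tE n : exists2 e, O e & t - u ^+ (Q ^ n) = i pi ^+ n * e.
  have [e he E] := t0E n; exists e; first exact: adjoin_vring_int hx he.
  have tel : \sum_(k < n) i pi ^+ k * g k = u ^+ (Q ^ n) - u.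
    elim: n {E} => [|n IHn]; first by rewrite big_ord0 expn0 expr1 subrr.
    by rewrite big_ord_recr /= IHn -gE addrC addrA subrK.
  by rewrite /t E tel; ring.
have tQ : t ^+ Q = t.
  apply/eqP; rewrite -subr_eq0;
    apply/eqP/(int_closure_separated v_pi Ks_alg) => n.
  have [e eO E] := tE n.
  have -> : t ^+ Q - t = (t - u ^+ (Q ^ n)) ^+ Q - (t - u ^+ (Q ^ n))
      + (u ^+ (Q ^ n.+1) - u ^+ (Q ^ n)).
    by rewrite /Q exprBpX -/Q -exprM -expnSr; ring.
  rewrite gE E exprMn.
  have -> : (i pi ^+ n) ^+ Q = i pi ^+ n * (i pi ^+ n) ^+ Q.-1.
    by rewrite -exprS prednK // ltnW.
  have pn0 : i pi ^+ n != 0 by rewrite expf_neq0.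
  have -> : (i pi ^+ n * i pi ^+ n ^+ Q.-1 * e ^+ Q - i pi ^+ n * e +
      i pi ^+ n * g n) / i pi ^+ n = i pi ^+ n ^+ Q.-1 * e ^+ Q - e + g n.
    by field.
  have pO : O (i pi) by apply/int_closureK/unif_vring.
  apply: int_closureD; last exact: adjoin_vring_int hx (hg n).
  apply: int_closureB => //; apply: int_closureM; last exact: int_closureX.
  by do 2!apply: int_closureX.
have tu : O ((u - t) / i pi).
  have [e eO E] := tE 1%N.
  have -> : u - t = - (t - u ^+ (Q ^ 1)) - (u ^+ Q - u) by rewrite expn1; ring.
  rewrite E uQ expr1 -mulrN -mulrBr mulrC mulKf //.
  apply: int_closureB; first exact: int_closureN.
  exact: int_closure_poly.
have tQn n : t ^+ (Q ^ n) = t.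
  by elim: n => [|n IHn]; rewrite ?expn0 ?expr1 // expnS exprM tQ.
(* [t] approximates x^(p^a), not [x]. Since t^(Q^a) = t, this power of [t] is its p^a-th root. *)
exists (t ^+ (p ^ ((b - a) * a - a))), a; split.
- exact: int_closureX.
- exists (b - a)%N; rewrite ?subn_gt0 // -exprM mulnC exprM.
  by rewrite -/Q tQ.
- rewrite exprBpX -exprM -expnD subnK; last first.
    by apply: leq_pmull; rewrite subn_gt0.
  by rewrite expnM -/Q tQn.
Qed.

(* The maximal ideal of the integral closure, see [int_closure_maxE]. *)
Definition top_nilpotent (x : Ks) := O x /\ exists k, O (x ^+ (p ^ k) / i pi).

Local Notation m := top_nilpotent.

Let p0 : i pi != 0. Proof. by rewrite fmorph_eq0 (unif_neq0 v_pi). Qed.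

Lemma top_nilpotent_le x k l : O x -> (k <= l)%N ->
  O (x ^+ (p ^ k) / i pi) -> O (x ^+ (p ^ l) / i pi).
Proof.
move=> hx /subnKC <-; rewrite expnD exprM => h.
have : (0 < p ^ (l - k))%N by rewrite expn_gt0 (ltnW p_gt1).
case: (p ^ (l - k))%N => // n _; rewrite exprS mulrAC.
by apply: int_closureM => //; do 2!apply: int_closureX.
Qed.

Lemma top_nilpotentD x y : m x -> m y -> m (x + y).
Proof.
move=> [hx [k hk]] [hy [l hl]]; split; first exact: int_closureD.
exists (maxn k l); rewrite exprDpX mulrDl; apply: int_closureD.
  exact: top_nilpotent_le (leq_maxl _ _) hk.
exact: top_nilpotent_le (leq_maxr _ _) hl.
Qed.

Lemma top_nilpotentMl x y : O x -> m y -> m (x * y).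
Proof.
move=> hx [hy [k hk]]; split; first exact: int_closureM.
by exists k; rewrite exprMn -mulrA; apply: int_closureM => //;
  apply: int_closureX.
Qed.

Lemma top_nilpotentN x : m x -> m (- x).
Proof.
by rewrite -mulN1r => h; apply: top_nilpotentMl => //;
  apply/int_closureN/int_closure1.
Qed.

Lemma top_nilpotentB x y : m x -> m y -> m (x - y).
Proof. by move=> hx /top_nilpotentN; apply: top_nilpotentD. Qed.

Lemma top_nilpotent0 : m 0.
Proof.
split; first exact: int_closure0.
by exists 0%N; rewrite expr1 mul0r; apply: int_closure0.
Qed.

Lemma top_nilpotent_unif x : O x -> m (i pi * x).
Proof.
move=> hx; split; first by apply: int_closureM => //;
  apply/int_closureK/unif_vring.
by exists 0%N; rewrite expr1 mulrC mulKf.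
Qed.

Lemma top_nilpotent_inv x : m x -> x != 0 -> ~ O x^-1.
Proof.
move=> [_ [k hk]] x0 /(@int_closureX _ _ _ _ _ (p ^ k)%N) /(int_closureM hk).
rewrite exprVn mulrAC divff ?expf_neq0 // mul1r.
exact: int_closure_invr_unif.
Qed.

Definition int_unit (x : Ks) := [/\ x != 0, O x & O x^-1].

Lemma int_unitM x y : int_unit x -> int_unit y -> int_unit (x * y).
Proof.
move=> [x0 hx hx'] [y0 hy hy']; split; rewrite ?mulf_neq0 ?invfM //;
  exact: int_closureM.
Qed.

Lemma int_unitV x : int_unit x -> int_unit x^-1.
Proof. by move=> [x0 hx hx']; split; rewrite ?invr_eq0 ?invrK. Qed.

Lemma int_unit1 : int_unit 1.
Proof. by split; rewrite ?oner_neq0 ?invr1 //; apply: int_closure1. Qed.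

Lemma int_unitX x n : int_unit x -> int_unit (x ^+ n).
Proof.
move=> hx; elim: n => [|n IHn]; first by rewrite expr0; apply: int_unit1.
by rewrite exprS; apply: int_unitM.
Qed.

Lemma int_unitK x : x != 0 -> v x = 0 -> int_unit (i x).
Proof.
move=> x0 vx; split; first by rewrite fmorph_eq0.
  by apply: int_closureK; rewrite inE /val_ge vx lexx orbT.
by rewrite -fmorphV; apply: int_closureK;
  rewrite inE /val_ge dvalV vx oppr0 lexx orbT.
Qed.

(** A p-power of 1 + y has the form 1 + pi w with [w] integral, a unit by the geometric series; an
    integral element with a unit power is a unit. *)
Lemma int_unit_add1 y : m y -> int_unit (1 + y).
Proof.
move=> [hy [k hk]].
have [w0 hw] := one_add_unif_unit v_pi Ks_alg v_complete hk.
have E : (1 + y) ^+ (p ^ k) = 1 + i pi * (y ^+ (p ^ k) / i pi).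
  by rewrite exprDpX expr1n mulrCA divff // mulr1.
rewrite -E in w0 hw.
have pk_gt0 : (0 < p ^ k)%N by rewrite expn_gt0 (ltnW p_gt1).
have y0 : 1 + y != 0.
  by apply: contra_neq w0 => ->; rewrite expr0n gtn_eqF.
have hy1 : O (1 + y) by apply: int_closureD => //; apply: int_closure1.
split=> //.
have -> : (1 + y)^-1 = (1 + y) ^+ (p ^ k).-1 * (1 + y) ^- (p ^ k).
  have c0 : (1 + y) ^+ (p ^ k).-1 != 0 by rewrite expf_neq0.
  by rewrite -{2}(prednK pk_gt0) exprS invfM mulrCA divff // mulr1.
by apply: int_closureM => //; apply: int_closureX.
Qed.

Lemma int_unitD x y : int_unit x -> m y -> int_unit (x + y).
Proof.
move=> hx hy; have [x0 _ hx'] := hx.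
have -> : x + y = x * (1 + x^-1 * y) by rewrite mulrDr mulr1 mulVKf.
by apply: int_unitM => //; apply/int_unit_add1/top_nilpotentMl.
Qed.

Lemma frob_periodic_int t : frob_periodic t -> O t.
Proof.
move=> [n n0 tn]; have pn : (1 < p ^ n)%N by rewrite -(exp1n n) ltn_exp2r.
apply: (@int_closure_root _ _ _ _ ('X^(p ^ n) - 'X)).
- by rewrite monicE lead_coefDl ?lead_coefXn // size_polyXn size_polyN
  size_polyX.
- by rewrite rootE !hornerE tn subrr.
- move=> k; rewrite coefB coefXn coefX.
  by apply: int_closureB; case: (_ == _);
    (exact: int_closure1 || exact: int_closure0).
Qed.

Lemma frob_periodicV t : frob_periodic t -> frob_periodic t^-1.
Proof. by move=> [n n0 tn]; exists n; rewrite // exprVn tn. Qed.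

Lemma frob_periodic_unit t : frob_periodic t -> t != 0 -> int_unit t.
Proof.
move=> ht t0; split=> //; apply: frob_periodic_int => //.
exact: frob_periodicV.
Qed.

Lemma frob_periodic_mul (t : Ks) n k : t ^+ (p ^ n) = t -> t ^+ (p ^ (n * k))
  = t.
Proof.
by move=> tn; elim: k => [|k IHk]; rewrite ?muln0 // mulnS expnD exprM tn.
Qed.

Lemma frob_periodic_op (op : Ks -> Ks -> Ks) s t :
    (forall x y n, op x y ^+ (p ^ n) = op (x ^+ (p ^ n)) (y ^+ (p ^ n))) ->
  frob_periodic s -> frob_periodic t -> frob_periodic (op s t).
Proof.
move=> hop [n n0 sn] [l l0 tl]; exists (n * l)%N; first by rewrite muln_gt0 n0.
by rewrite hop (frob_periodic_mul _ sn) [(n * l)%N]mulnC (frob_periodic_mul _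
  tl).
Qed.

Lemma frob_periodicD s t :
  frob_periodic s -> frob_periodic t -> frob_periodic (s + t).
Proof. by apply: frob_periodic_op => *; rewrite exprDpX. Qed.

Lemma frob_periodicB s t :
  frob_periodic s -> frob_periodic t -> frob_periodic (s - t).
Proof. by apply: (@frob_periodic_op (fun x y => x - y)) => *;
  rewrite exprBpX. Qed.

Lemma frob_periodicM s t :
  frob_periodic s -> frob_periodic t -> frob_periodic (s * t).
Proof. by apply: frob_periodic_op => *; rewrite exprMn. Qed.

Lemma frob_periodic1 : frob_periodic 1.
Proof. by exists 1%N; rewrite ?expr1n. Qed.

Lemma frob_periodic_nil t : frob_periodic t -> m t -> t = 0.
Proof.
move=> ht mt; apply/eqP; apply: contraT => t0; exfalso.
by have [_ _] := frob_periodic_unit ht t0; apply: top_nilpotent_inv.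
Qed.

Lemma residue_lift x : O x -> exists2 t, frob_periodic t & m (x - t).
Proof.
move=> hx; have [t [k [tO ht hk]]] := frob_periodic_lift hx.
by exists t => //; split; [apply: int_closureB | exists k].
Qed.

(** If the Teichmueller representative of [x] is nonzero, it is a unit, and so is [x], which differs
    from it by a topologically nilpotent element. *)
Lemma int_closure_maxE x : int_closure_max i v x <-> m x.
Proof.
split=> [[hx hx']|mx]; last first.
  split; first by case: mx.
  by have [->|x0] := eqVneq x 0; [left | right; apply: top_nilpotent_inv].
have [t ht mxt] := residue_lift hx.
have [t0|t0] := eqVneq t 0; first by rewrite t0 subr0 in mxt.
have [x0 _ xu] : int_unit x.
  by rewrite -(subrK t x) addrC; apply: int_unitD => //;
    apply: frob_periodic_unit.
by case: hx' => // x00; rewrite x00 eqxx in x0.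
Qed.

Section Inertia.
Variable g : {rmorphism Ks -> Ks}.
Hypothesis gK : forall x : K, g (i x) = i x.

Lemma galois_int_closure x : O x -> O (g x).
Proof.
move=> [P [Pm PV Px]]; exists P; split=> //.
by rewrite -(eq_map_poly gK) map_poly_comp fmorph_root.
Qed.

Lemma galois_top_nilpotent x : m x -> m (g x).
Proof.
move=> [hx [k hk]]; split; first exact: galois_int_closure.
by exists k; rewrite -rmorphXn -gK -fmorphV -rmorphM; apply: galois_int_closure.
Qed.

Lemma galois_frob_periodic t : frob_periodic t -> frob_periodic (g t).
Proof. by move=> [n n0 tn]; exists n => //; rewrite -rmorphXn tn. Qed.

End Inertia.

(** Periodic elements represent every residue, and g t - t is again periodic, so it vanishes as soon
    as it lies in the maximal ideal. *)
Lemma inertiaE (g : {rmorphism Ks -> Ks}) : inertia_group i v g <->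
  galois_group i g /\ forall t, frob_periodic t -> g t = t.
Proof.
split=> [[hg hO]|[hg hE]]; split=> //; have [_ gK] := hg.
  move=> t ht; apply/eqP; rewrite -subr_eq0; apply/eqP.
  apply: frob_periodic_nil.
    by apply: frob_periodicB => //; apply: galois_frob_periodic.
  by apply/int_closure_maxE/hO/frob_periodic_int.
move=> y /residue_lift[t ht mt]; apply/int_closure_maxE.
have -> : g y - y = g (y - t) - (y - t).
  by rewrite rmorphB /= (hE t ht) opprB addrA subrK.
by apply: top_nilpotentB => //; apply: galois_top_nilpotent.
Qed.

End ResidueField.

(** * The fixed field of inertia *)

Section Unramified.
Variables (K : fieldType) (v : dvaluation K) (pi : K).
Hypothesis v_pi : v pi = 1.
Hypotheses (v_complete : vcomplete v) (v_finite : finite_residue_field v).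
Variables (Ks : fieldType) (i : {rmorphism K -> Ks}).
Hypothesis hKs : separable_closure i.
Variable p : nat.
Hypothesis p_char : p \in [pchar K].

Local Notation O := (int_closure i v).
Local Notation m := (@top_nilpotent K v pi Ks i p).
Local Notation periodic := (@frob_periodic Ks p).

Let p_charKs : p \in [pchar Ks]. Proof. by rewrite (fmorph_pchar i). Qed.

Lemma separable_closure_algebraic (y : Ks) : algebraicOver i y.
Proof. by have [P sP Py] := hKs.1 y; exists P;
  rewrite ?separable_poly_neq0. Qed.
Let Ks_alg := separable_closure_algebraic.

(** The Teichmueller construction is applied to [K] as an extension of itself, so that the
    representative lies in [K]. *)
Lemma base_residue_lift x : x \in vring v ->
  exists2 t, periodic (i t) & x - t \in vmax v.
Proof.
move=> hx.
have K_alg (y : K) : algebraicOver idfun y.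
  by exists ('X - y%:P); rewrite ?polyXsubC_eq0 // map_poly_id // root_XsubC.
have xO := int_closureK (idfun : {rmorphism K -> K}) hx.
have [t [k [tO [n n0 tn] hk]]] := frob_periodic_lift v_pi v_complete v_finite
  K_alg p_char xO.
exists t; first by exists n; rewrite // -rmorphXn tn.
have tV := int_closure_vring v_pi tO; have {}hk := int_closure_vring v_pi hk.
apply: contraT => /(vring_unit (rpredB hx tV))[y0 yV].
have := invr_unif_vring v_pi; rewrite -(mulKf (expf_neq0 (p ^ k) y0) pi^-1).
by rewrite rpredM // -exprVn rpredX.
Qed.

(* The maximal unramified extension of K is the compositum of K with the
   algebraic closure of the prime field. *)
Definition unramified (z : Ks) := exists2 l : seq (K * Ks),
  forall c, c \in l -> periodic c.2 & z = \sum_(c <- l) i c.1 * c.2.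

Let dominant (l : seq (K * Ks)) : (forall c, c \in l -> c.1 = 0) \/
  exists2 x, x \in l & x.1 != 0 /\ forall y, y \in l -> y.1 / x.1 \in vring v.
Proof.
elim: l => [|a l [l0|[x xl [x0 xmin]]]]; first by left.
  have [a0|a0] := eqVneq a.1 0.
    by left=> c; rewrite inE => /predU1P[->|/l0].
  right; exists a; rewrite ?mem_head //; split=> // y.
  by rewrite inE => /predU1P[->|/l0 ->]; rewrite ?divff ?rpred1 ?mul0r ?rpred0.
right; case: (boolP (a.1 / x.1 \in vring v)) => [ax|ax].
  exists x; first by rewrite inE xl orbT.
  by split=> // y; rewrite inE => /predU1P[->//|/xmin].
have a0 : a.1 != 0 by apply: contraNneq ax => ->; rewrite mul0r rpred0.
exists a; rewrite ?mem_head //; split=> // y;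
  rewrite inE => /predU1P[->|/xmin yx].
  by rewrite divff ?rpred1.
have -> : y.1 / a.1 = (y.1 / x.1) * (x.1 / a.1) by rewrite mulrA divfK.
apply: rpredM => //; move: ax;
  rewrite !inE /val_ge negb_or -ltNge => /andP[_ ax].
by rewrite -invf_div dvalV oppr_ge0 (ltW ax) orbT.
Qed.

(** The compositum has the same value group as [K]. A coefficient of least valuation is factored
    out, and the other ratios are replaced by Teichmueller representatives; if the resulting
    periodic sum [s] is nonzero, it is a unit and the rest is topologically nilpotent after
    division. *)
Lemma unramified_val z : unramified z -> z != 0 ->
  exists2 c, c != 0 & int_unit v i (z / i c).
Proof.
move=> [l hl ->]; have [n le_n] := ubnP (size l).
elim: n l hl le_n => // n IHn l hl le_n z0.
have [l0|[x xl [x0 xmin]]] := dominant l.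
  by rewrite big_seq big1 ?eqxx // in z0 => c /l0 ->; rewrite rmorph0 mul0r.
have /choice[t tP] : forall r : K, exists t, r \in vring v ->
    periodic (i t) /\ r - t \in vmax v.
  move=> r; case: (boolP (r \in vring v)) => [/base_residue_lift[t ? ?]|_];
    last by exists 0.
  by exists t.
have lE := perm_to_rem xl; set l' := rem x l in lE.
have l'l y : y \in l' -> y \in l by apply: mem_rem.
pose s := x.2 + \sum_(y <- l') i (t (y.1 / x.1)) * y.2.
have ix0 : i x.1 != 0 by rewrite fmorph_eq0.
have zE : (\sum_(y <- l) i y.1 * y.2) = i x.1 * s +
    \sum_(y <- l') i (y.1 - x.1 * t (y.1 / x.1)) * y.2.
  rewrite (perm_big _ lE) big_cons /= /s mulrDr -addrA mulr_sumr -big_split /=.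
  by congr (_ + _); apply: eq_bigr => y _; rewrite rmorphB rmorphM; ring.
(* When [s] vanishes, it expresses [x.2] through the other terms, and the sum can be rewritten with
   one term fewer. *)
have [s0|s0] := eqVneq s 0.
  pose l2 := [seq (y.1 - x.1 * t (y.1 / x.1), y.2) | y <- l'].
  have zE2 : \sum_(y <- l) i y.1 * y.2 = \sum_(y <- l2) i y.1 * y.2.
    by rewrite zE s0 mulr0 add0r big_map.
  rewrite zE2; apply: IHn; last by rewrite -zE2.
    by move=> c /mapP[y /l'l yl ->] /=; apply: hl.
  by rewrite size_map size_rem //; case: (size l) (perm_size lE) le_n.
have sP : periodic s.
  have psum (r : seq (K * Ks)) : {subset r <= l} ->
      periodic (\sum_(y <- r) i (t (y.1 / x.1)) * y.2).
    elim: r => [|y r IHr] rl.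
      by rewrite big_nil -(subrr 1); apply: frob_periodicB => //;
        apply: frob_periodic1.
    rewrite big_cons; apply: (frob_periodicD p_charKs); last first.
      by apply: IHr => c cr; apply: rl; rewrite inE cr orbT.
    have yl : y \in l by apply/rl/mem_head.
    by apply: frob_periodicM; [apply: (tP _ (xmin _ yl)).1 | apply: hl].
  by apply: (frob_periodicD p_charKs); [apply: hl | apply: psum].
exists x.1 => //; rewrite zE mulrDl mulrC mulKf //.
apply: (int_unitD v_pi v_complete Ks_alg p_charKs).
  exact: (frob_periodic_unit _ _ p_charKs).
have msum (r : seq (K * Ks)) : {subset r <= l} ->
    m ((\sum_(y <- r) i (y.1 - x.1 * t (y.1 / x.1)) * y.2) / i x.1).
  elim: r => [|y r IHr] rl; first by rewrite big_nil mul0r;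
    apply: top_nilpotent0.
  rewrite big_cons mulrDl; apply: top_nilpotentD => //; last first.
    by apply: IHr => c cr; apply: rl; rewrite inE cr orbT.
  have yl : y \in l by apply/rl/mem_head.
  have [e he eE] := vmaxP v_pi _ (tP _ (xmin _ yl)).2.
  have -> : i (y.1 - x.1 * t (y.1 / x.1)) * y.2 / i x.1 = i pi * (i e * y.2).
    have -> : y.1 - x.1 * t (y.1 / x.1) = x.1 * (pi * e).
      by rewrite -eE mulrBr [x.1 * (y.1 / _)]mulrC divfK.
    by rewrite !rmorphM; field.
  apply: top_nilpotent_unif => //; apply: int_closureM;
    first exact: int_closureK.
  exact/frob_periodic_int/hl.
exact: msum.
Qed.

Lemma unramifiedD y z : unramified y -> unramified z -> unramified (y + z).
Proof.
move=> [l hl ->] [l' hl' ->]; exists (l ++ l'); last by rewrite big_cat.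
by move=> c; rewrite mem_cat => /orP[/hl|/hl'].
Qed.

Lemma unramifiedM y z : unramified y -> unramified z -> unramified (y * z).
Proof.
move=> [l hl ->] [l' hl' ->].
exists [seq (c.1 * d.1, c.2 * d.2) | c <- l, d <- l'].
  by move=> _ /allpairsP[[c d] /= [/hl hc /hl' hd ->]]; apply: frob_periodicM.
rewrite big_allpairs_dep mulr_suml; apply: eq_bigr => c _; rewrite mulr_sumr.
by apply: eq_bigr => d _ /=; rewrite rmorphM; ring.
Qed.

Lemma unramifiedK k : unramified (i k).
Proof.
exists [:: (k, 1)]; last by rewrite big_seq1 mulr1.
by move=> c; rewrite inE => /eqP -> /=; apply: frob_periodic1.
Qed.

Lemma unramifiedB y z : unramified y -> unramified z -> unramified (y - z).
Proof.
move=> hy hz; apply: unramifiedD => //; rewrite -mulN1r -(rmorphN1 i).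
by apply: unramifiedM => //; apply: unramifiedK.
Qed.

Lemma unramifiedV z : unramified z -> unramified z^-1.
Proof.
have [->|z0] := eqVneq z 0; first by rewrite invr0.
move=> hz; have [P /rootP Pz P0] := root_nonzero_const hKs z0.
have hX n : unramified (z ^+ n).
  elim: n => [|n IHn]; first by rewrite expr0 -(rmorph1 i); apply: unramifiedK.
  by rewrite exprS; apply: unramifiedM.
move: Pz; rewrite horner_coef size_map_poly.
have Ps : (0 < size P)%N.
  by rewrite size_poly_gt0; apply: contraNneq P0 => ->; rewrite coef0.
rewrite -(prednK Ps) big_ord_recl /= expr0 mulr1 coef_map /=.
set S := \sum_(_ < _) _ => /eqP; rewrite addr_eq0 => /eqP ES.
have iP0 : i P`_0 != 0 by rewrite fmorph_eq0.
have -> : z^-1 = \sum_(k < (size P).-1) i (- P`_k.+1 / P`_0) * z ^+ k.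
  apply: (mulfI z0); rewrite divff // mulr_sumr.
  apply: (mulfI iP0); rewrite mulr1 [LHS]ES mulr_sumr -sumrN.
  apply: eq_bigr => k _.
  rewrite /bump leq0n add1n coef_map exprS /= rmorphM rmorphN fmorphV.
  by field.
elim/big_ind: _ => [||k _]; last by apply: unramifiedM => //;
  apply: unramifiedK.
  by rewrite -(rmorph0 i); apply: unramifiedK.
exact: unramifiedD.
Qed.

(** If [z] is not in the compositum, it has another conjugate over it; moving [z] there extends to
    an automorphism that fixes all periodic elements, so it lies in inertia. *)
Lemma unramified_fixed z :
    (forall g, inertia_group i v g -> g z = z) -> unramified z.
Proof.
move=> gz; apply: contrapT => nz.
pose R := [set l : Ks * Ks | unramified l.1 /\ l.2 = l.1].
have hR : partial_hom i R.
  split=> [k|x x' y y'|x x' y y'|x'].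
  - by split=> //=; apply: unramifiedK.
  - by move=> [hx /= ->] [hy /= ->]; split=> //=; apply: unramifiedB.
  - by move=> [hx /= ->] [hy /= ->]; split=> //=; apply: unramifiedM.
  - by move=> [].
have [f [f' [rf fz sz_f sf' f'P]]] := poly_rel_min hKs hR z.
have f'E : f' = f by apply/polyP => k; have [] := rf k.
rewrite {}f'E in rf sf' f'P.
have [rs uniq_rs fE] := sep_closed_roots hKs sf'.
have rsE y : root f y = (y \in rs).
  by rewrite fE rootZ ?root_prod_XsubC // lead_coef_eq0 separable_poly_neq0.
(* With [z] as its only root, the separable polynomial [f] would be linear, and [z] a quotient of
   unramified elements. *)
have [z' z'rs z'z] : exists2 z', z' \in rs & z' != z.
  apply: contrapT => nz'; apply: nz.
  have rsz : rs = [:: z].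
    have zrs : z \in rs by rewrite -rsE.
    have all_z : forall y, y \in rs -> y = z.
      by move=> y yrs; apply/eqP; apply: contraT => yz; case: nz'; exists y.
    case: (rs) uniq_rs all_z zrs => [//|a [|b r]] /=.
      by move=> _ h _; rewrite (h a) ?mem_head.
    by move=> + h; rewrite (h a) ?mem_head // (h b) !inE ?eqxx // orbT.
  have f0E : f`_0 = - lead_coef f * z.
    by rewrite {1}fE rsz big_seq1 coefZ coefB coefX coefC /= sub0r mulrN mulNr.
  have lf0 : lead_coef f != 0 by rewrite lead_coef_eq0 separable_poly_neq0.
  have -> : z = 0 - f`_0 / lead_coef f by rewrite f0E; field.
  apply: unramifiedB; first by rewrite -(rmorph0 i); apply: unramifiedK.
  apply: unramifiedM; first by have [] := rf 0%N.
  by apply: unramifiedV; rewrite lead_coefE; have [] := rf (size f).-1.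
have hroot h h' : poly_rel R h h' -> root h z -> root h' z'.
  by move=> rh hz; apply: (root_dvdp (f'P _ _ rh hz)); rewrite rsE.
have [hR' RR' R'z] := partial_hom_adjoin hR hroot.
have [g [hg gE]] := partial_hom_extend hKs hR'.
have : g z = z.
  apply: gz; apply/(inertiaE v_pi v_complete v_finite Ks_alg p_charKs);
    split=> // t ht.
  apply/gE/RR'; split=> //=; exists [:: (1, t)]; last first.
    by rewrite big_seq1 rmorph1 mul1r.
  by move=> c; rewrite inE => /eqP ->.
by rewrite (gE _ _ R'z) => /eqP; rewrite (negPf z'z).
Qed.

End Unramified.

(** * The action of a Drinfeld module *)

Section DrinfeldAction.
Variables (Fq : finFieldType) (F K : fieldType).
Variables (vinf : dvaluation F) (vK : dvaluation K).
Variables (D : drinfeld_module Fq vinf vK).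
Variables (Ks : fieldType) (i : {rmorphism K -> Ks}) (jK : {rmorphism Fq -> K}).
Local Notation q := #|Fq|.
Local Notation A := (regular_ring vinf).
Local Notation act := (drinfeld_act D i).

Lemma skew_eval_wide (L : fieldType) (h : {rmorphism K -> L}) n (f : {poly K})
  x :
  (size f <= n)%N -> skew_eval q h f x = \sum_(j < n) h f`_j * x ^+ (q ^ j).
Proof.
move=> le_n; rewrite /skew_eval -!(big_mkord xpredT (fun j =>
  h f`_j * x ^+ (q ^ j))).
rewrite [RHS](@big_cat_nat _ _ _ (size f)) //= [X in _ + X]big_nat_cond.
rewrite [X in _ + X]big1 ?addr0 // => j /andP[/andP[szj _] _].
by rewrite nth_default // rmorph0 mul0r.
Qed.

Section CharExponent.
Variable p : nat.
Hypothesis p_char : p \in [pchar Fq].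

Lemma card_pX : exists2 f, (0 < f)%N & q = (p ^ f)%N.
Proof.
have E := card_pprimeChar p_char; exists (logn p q); last exact: E.
rewrite lt0n; apply/eqP => l0; have := finNzRing_gt1 Fq.
by rewrite E l0 expn0.
Qed.

Lemma q_gt0 n : (0 < q ^ n)%N.
Proof. by rewrite expn_gt0 (ltnW (finNzRing_gt1 Fq)). Qed.

Lemma pchar_base : p \in [pchar K]. Proof. by rewrite (fmorph_pchar jK). Qed.

Lemma pchar_ext : p \in [pchar Ks].
Proof. by rewrite (fmorph_pchar i) pchar_base. Qed.

Lemma exprDqX (x y : Ks) k : (x + y) ^+ (q ^ k) = x ^+ (q ^ k) + y ^+ (q ^ k).
Proof. by have [f _ ->] := card_pX; rewrite -expnM exprDpX // pchar_ext. Qed.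

Lemma actDr a x y : act a (x + y) = act a x + act a y.
Proof.
rewrite /drinfeld_act /skew_eval -big_split /=; apply: eq_bigr => k _.
by rewrite exprDqX mulrDr.
Qed.

Lemma act0r a : act a 0 = 0.
Proof. by apply: (addrI (act a 0)); rewrite -actDr !addr0. Qed.

Lemma actNr a x : act a (- x) = - act a x.
Proof. by apply/eqP; rewrite -addr_eq0 -actDr addNr act0r. Qed.

Lemma actBr a x y : act a (x - y) = act a x - act a y.
Proof. by rewrite actDr actNr. Qed.

Lemma skew_evalD (f g : {poly K}) (x : Ks) :
  skew_eval q i (f + g) x = skew_eval q i f x + skew_eval q i g x.
Proof.
pose n := maxn (size (f + g)) (maxn (size f) (size g)).
rewrite !(@skew_eval_wide _ _ n) -?big_split /=; last 3 first.
- by rewrite !leq_max leqnn !orbT.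
- by rewrite !leq_max leqnn orbT.
- by rewrite leq_max leqnn.
by apply: eq_bigr => k _; rewrite coefD rmorphD mulrDl.
Qed.

Lemma actD a b x : act (a + b) x = act a x + act b x.
Proof. by rewrite /drinfeld_act dphiD skew_evalD. Qed.

Lemma act1 x : act 1 x = x.
Proof.
by rewrite /drinfeld_act dphi1 /skew_eval size_poly1 big_ord1 coef1 rmorph1
  mul1r.
Qed.

Lemma actM a b x : act (a * b) x = act a (act b x).
Proof.
rewrite /drinfeld_act dphiM /skew_mul.
have ev_sum n (h : 'I_n -> {poly K}) :
    skew_eval q i (\sum_(k < n) h k) x = \sum_(k < n) skew_eval q i (h k) x.
  elim/big_rec2: _ => [|k y f _ <-]; last exact: skew_evalD.
  by rewrite /skew_eval size_poly0 big_ord0.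
rewrite ev_sum [RHS]/skew_eval; apply: eq_bigr => k _; rewrite ev_sum.
have -> : skew_eval q i (D b) x ^+ (q ^ k) =
    \sum_(l < size (D b)) (i (D b)`_l * x ^+ (q ^ l)) ^+ (q ^ k).
  rewrite /skew_eval; elim/big_rec2: _ => [|l y z _ <-]; last exact: exprDqX.
  by rewrite expr0n gtn_eqF // q_gt0.
rewrite mulr_sumr; apply: eq_bigr => l _.
set c := _ * _ ^+ _; rewrite (@skew_eval_wide _ _ (k + l).+1); last first.
  by apply: leq_trans (size_scale_leq _ _) _; rewrite size_polyXn.
rewrite big_ord_recr big1 /= ?add0r => [|n _]; last first.
  by rewrite coefZ coefXn ltn_eqF // mulr0 rmorph0 mul0r.
rewrite coefZ coefXn eqxx mulr1 /c rmorphM rmorphXn exprMn -mulrA -exprM.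
by rewrite -expnD addnC.
Qed.

Lemma act_galois (g : {rmorphism Ks -> Ks}) a x :
  (forall k, g (i k) = i k) -> g (act a x) = act a (g x).
Proof.
move=> gK; rewrite rmorph_sum; apply: eq_bigr => k _.
by rewrite rmorphM rmorphXn /= gK.
Qed.

(** The complement of [residual_char]: here the constant coefficient is a unit, so the [c]-torsion
    is etale over the valuation ring. *)
Definition away (c : A) := (D c)`_0 \notin vmax vK.

Lemma dphi_coef c k : (D c)`_k \in vring vK.
Proof. by have /polyOverP := dphi_int D c. Qed.

Lemma awayM b c : away b -> away c -> away (b * c).
Proof.
rewrite /away => /(vring_unit (dphi_coef b 0))[b0 bV].
move=> /(vring_unit (dphi_coef c 0))[c0 cV].
have -> : (D (b * c))`_0 = (D b)`_0 * (D c)`_0.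
  have sz (a : A) : (D a)`_0 != 0 -> (0 < size (D a))%N.
    by rewrite size_poly_gt0; apply: contraNneq => ->; rewrite coef0.
  rewrite dphiM /skew_mul -(prednK (sz b b0)) -(prednK (sz c c0)).
  rewrite coef_sum big_ord_recl coef_sum big_ord_recl /=.
  rewrite coefZ coefXn mulr1 expn0 expr1 !big1 ?addr0 // => k _.
    rewrite coef_sum big1 // => l _.
    by rewrite coefZ coefXn /bump leq0n add1n mulr0.
  by rewrite coefZ coefXn /bump leq0n add1n mulr0.
rewrite inE /val_ge mulf_eq0 (negPf b0) (negPf c0) /= dvalM //.
by rewrite (dval_unit b0) ?(dval_unit c0) ?dphi_coef.
Qed.

Lemma away1 : away 1.
Proof. by rewrite /away dphi1 coef1 inE /val_ge oner_eq0 dval1. Qed.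

Lemma away_neq0 c : away c -> c != 0.
Proof.
apply: contraNneq => ->;
  have /(congr1 (fun f : {poly K} => f`_0)) := dphiD D 0 0.
rewrite addr0 coefD => /eqP; rewrite -{1}[_`_0]addr0 => /eqP/addrI <-.
by rewrite inE /val_ge eqxx.
Qed.

Lemma has_index_le (B : zmodType) (I : set B) n k :
    I 0 -> (forall x y, I x -> I y -> I (x - y)) ->
  has_index I n -> has_index I k -> (n <= k)%N.
Proof.
move=> I0 IB [s hs] [t ht].
have IN x : I x -> I (- x) by move=> /(IB _ _ I0); rewrite sub0r.
have /choice[f fP] : forall a : 'I_n, exists b : 'I_k, I (tnth s a - tnth t b).
  by move=> a; have [b [hb _]] := ht (tnth s a); exists b.
suff /leq_card : injective f by rewrite !card_ord.
move=> a b fab; have := IB _ _ (fP a) (fP b);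
  rewrite fab opprB addrA subrK => h.
have [c [_ hc]] := hs (tnth s a); rewrite -(hc b h).
by apply/esym/hc; rewrite subrr.
Qed.

(** Good reduction in usable form: the index of cA determines the degree of [c], and the ranks
    before and after reduction agree, so the top coefficient is a unit. *)
Lemma dphi_degree c : c != 0 -> exists d,
  size (D c) = d.+1 /\ (D c)`_d \notin vmax vK.
Proof.
move=> c0; have [r [h1 h2]] := dphi_good D.
have [d1 [i1 [t1 z1]]] := h1 c c0; have [d2 [i2 [t2 _]]] := h2 c c0.
have I0 : range (fun b : A => c * b) 0 by exists 0; rewrite ?mulr0.
have IB (x y : A) : range (fun b : A => c * b) x -> range (fun b : A =>
  c * b) y ->
    range (fun b : A => c * b) (x - y).
  by move=> [x' _ <-] [y' _ <-]; exists (x' - y'); rewrite ?mulrBr.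
have dE : d1 = d2.
  have le12 := has_index_le I0 IB i1 i2; have le21 := has_index_le I0 IB i2 i1.
  rewrite !leq_exp2l ?finNzRing_gt1 // in le12 le21.
  by apply/eqP; rewrite eqn_leq le12 le21.
rewrite dE in t1 z1; exists (r * d2)%N; split=> //.
apply/eqP; rewrite eqn_leq; apply/andP; split.
  by apply/leq_sizeP => k /z1; rewrite inE => /eqP.
by rewrite ltnNge; apply: contraNN t1 => /leq_sizeP/(_ _ (leqnn _)) ->;
  rewrite inE.
Qed.

Definition act_poly c : {poly Ks} := \sum_(j < size (D c)) (i (D c)`_j) *:
  'X^(q ^ j).

Lemma act_polyE c x : (act_poly c).[x] = act c x.
Proof. by rewrite horner_sum; apply: eq_bigr => k _;
  rewrite hornerZ hornerXn. Qed.

Lemma size_act_poly c d : size (D c) = d.+1 ->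
  size (act_poly c) = (q ^ d).+1 /\ lead_coef (act_poly c) = i (D c)`_d.
Proof.
move=> sz; rewrite /act_poly sz big_ord_recr /=.
have cd0 : i (D c)`_d != 0.
  by rewrite fmorph_eq0 -[d]/d.+1.-1 -sz -lead_coefE lead_coef_eq0
    -size_poly_eq0 sz.
have sX : size (i (D c)`_d *: 'X^(q ^ d)) = (q ^ d).+1.
  by rewrite size_scale // size_polyXn.
set S := \sum_(_ < d) _.
have lt_S : (size S < (q ^ d).+1)%N.
  rewrite ltnS; apply: leq_trans (size_sum _ _ _) _; apply/bigmax_leqP => k _.
  apply: leq_trans (size_scale_leq _ _) _; rewrite size_polyXn.
  by rewrite ltn_exp2l ?finNzRing_gt1 // ltn_ord.
rewrite addrC size_polyDl ?sX // lead_coefDl ?sX // lead_coefZ lead_coefXn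
  mulr1.
by [].
Qed.

(** Since q = 0 in [Ks], the derivative is the constant (D c)_0. *)
Lemma act_poly_separable c (y : Ks) : (D c)`_0 != 0 ->
  separable_poly (act_poly c - y%:P).
Proof.
move=> c0; rewrite unlock.
have q0 : (q%:R : Ks) = 0.
  by have [f f0 ->] := card_pX;
    rewrite natrX (pcharf0 pchar_ext) expr0n gtn_eqF.
have -> : (act_poly c - y%:P)^`() = (i (D c)`_0)%:P.
  rewrite derivB derivC subr0 /act_poly.
  have sz : (0 < size (D c))%N.
    by rewrite size_poly_gt0; apply: contraNneq c0 => ->; rewrite coef0.
  rewrite -(prednK sz) big_ord_recl derivD derivZ expn0 derivX alg_polyC.
  rewrite raddf_sum big1 ?addr0 // => k _.
  rewrite /= derivZ derivXn /bump leq0n add1n expnS -mulr_natr natrM.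
  by rewrite -polyC_natr q0 mul0r mulr0 scaler0.
by rewrite -[X in coprimep _ X]alg_polyC coprimepZr ?fmorph_eq0 // coprimep1.
Qed.

Hypothesis hKs : separable_closure i.

Lemma act_surj c y : away c -> exists x, act c x = y.
Proof.
move=> hc; have [c0 _] := vring_unit (dphi_coef c 0) hc.
have [d [sz _]] := dphi_degree (away_neq0 hc).
have [szP _] := size_act_poly sz.
have [|x /rootP] := hKs.2 _ (act_poly_separable y c0).
  have lt_y : (size (- y%:P)%R < size (act_poly c))%N.
    by rewrite szP size_polyN ltnS (leq_trans (size_polyC_leq1 _)) ?q_gt0.
  by rewrite size_polyDl // szP ltnS q_gt0.
rewrite !hornerE act_polyE => /eqP; rewrite subr_eq0 => /eqP; by exists x.
Qed.

Lemma act_kernel c d : away c -> size (D c) = d.+1 ->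
  exists V : seq Ks, [/\ uniq V, size V = (q ^ d)%N &
    forall x, (x \in V) = (act c x == 0)].
Proof.
move=> hc sz; have [c0 _] := vring_unit (dphi_coef c 0) hc.
have [szP _] := size_act_poly sz.
have sep := act_poly_separable 0 c0; rewrite polyC0 subr0 in sep.
have [V uV VE] := sep_closed_roots hKs sep; exists V; split=> // [|x].
  have := congr1 (fun f : {poly Ks} => size f) VE; rewrite /= szP.
  rewrite size_scale ?size_prod_XsubC ?lead_coef_eq0 ?separable_poly_neq0 //.
  by case.
by rewrite -act_polyE -rootE VE rootZ ?root_prod_XsubC // lead_coef_eq0
  separable_poly_neq0.
Qed.

End CharExponent.
End DrinfeldAction.

(** * The Kummer image at a principal level *)

Section KummerImage.
Variables (Fq : finFieldType) (F K : fieldType).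
Variables (vinf : dvaluation F) (vK : dvaluation K).
Hypothesis hK : local_field vK.
Variables (jK : {rmorphism Fq -> K}) (Ks : fieldType) (i : {rmorphism K -> Ks}).
Hypothesis hKs : separable_closure i.
Variable D : drinfeld_module Fq vinf vK.
Variable lam : K.
Hypothesis hlam : lam \notin vring vK.
Variable p : nat.
Hypothesis p_char : p \in [pchar Fq].
Variable pi : K.
Hypothesis v_pi : vK pi = 1.

Local Notation q := #|Fq|.
Local Notation A := (regular_ring vinf).
Local Notation act := (drinfeld_act D i).
Local Notation O := (int_closure i vK).
Local Notation m := (@top_nilpotent K vK pi Ks i p).
Local Notation inertia := (inertia_group i vK).
Local Notation away := (@away Fq F K vinf vK D).

Let v_complete := hK.1.
Let v_finite := hK.2.
Let Ks_alg := separable_closure_algebraic hKs.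
Let p_charK := pchar_base jK p_char.
Let p_charKs := pchar_ext i jK p_char.
Let q_gt1 := finNzRing_gt1 Fq.

Let act0r := act0r D i jK p_char.
Let actBr := actBr D i jK p_char.

Lemma act_dom_int c k : O (i (D c)`_k).
Proof. exact/int_closureK/dphi_coef. Qed.

Lemma torsion_int c x : away c -> act c x = 0 -> O x.
Proof.
move=> hc cx; have [d [sz ld]] := dphi_degree D (away_neq0 hc).
have [szP lP] := size_act_poly i sz.
have [l0 lV] := vring_unit (dphi_coef D c d) ld.
apply: (@int_closure_root _ _ _ _ ((lead_coef (act_poly D i c))^-1 *: act_poly
  D i c)).
- by rewrite monicE lead_coefZ mulVf // lP fmorph_eq0.
- by rewrite rootE hornerZ act_polyE cx mulr0.
move=> k; rewrite coefZ lP -fmorphV; apply: int_closureM;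
  first exact: int_closureK.
rewrite coef_sum; elim/big_ind: _ => [||l _]; first exact: int_closure0.
  exact: int_closureD.
rewrite coefZ coefXn; apply: int_closureM; first exact: act_dom_int.
by case: (_ == _); [apply: int_closure1 | apply: int_closure0].
Qed.

(** Reduction is injective on torsion: D_c(x) is [x] times the unit (D c)_0 plus topologically
    nilpotent terms. *)
Lemma torsion_nil c x : away c -> act c x = 0 -> m x -> x = 0.
Proof.
move=> hc cx mx; apply/eqP; apply: contraT => x0; exfalso.
have [c0 cV] := vring_unit (dphi_coef D c 0) hc.
have sz : (0 < size (D c))%N.
  by rewrite size_poly_gt0; apply: contraNneq c0 => ->; rewrite coef0.
have [u0 _ _] : int_unit vK i (i (D c)`_0 +
    \sum_(k < (size (D c)).-1) i (D c)`_k.+1 * x ^+ (q ^ k.+1).-1).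
  apply: (int_unitD v_pi v_complete Ks_alg p_charKs).
    by apply: int_unitK => //; apply: dval_unit => //; apply: dphi_coef.
  elim/big_ind: _ => [||k _]; first exact: top_nilpotent0.
    exact: (top_nilpotentD p_charKs).
  apply: top_nilpotentMl; first exact: act_dom_int.
  have : (1 < q ^ k.+1)%N by rewrite -{1}(exp1n k.+1) ltn_exp2r.
  case: (q ^ k.+1)%N => [|[|n]] // _; rewrite exprSr;
    apply: top_nilpotentMl => //.
  by apply: int_closureX; case: mx.
move: cx; rewrite /drinfeld_act /skew_eval -(prednK sz) big_ord_recl /=.
rewrite expn0 expr1 => /eqP; apply/negP.
rewrite (_ : _ + _ = x * (i (D c)`_0 +
    \sum_(k < (size (D c)).-1) i (D c)`_k.+1 * x ^+ (q ^ k.+1).-1)).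
  by rewrite mulf_neq0.
rewrite mulrDr [x * i _]mulrC mulr_sumr; congr (_ + _); apply: eq_bigr => k _.
rewrite /bump leq0n add1n mulrCA -exprS prednK // expn_gt0.
by rewrite (ltnW q_gt1).
Qed.

Lemma inertia_galois g : inertia g -> forall k, g (i k) = i k.
Proof. by move=> [[_ gK] _]. Qed.

Lemma inertia_act g a x : inertia g -> g (act a x) = act a (g x).
Proof. by move=> /inertia_galois; apply: act_galois. Qed.

(** Good reduction makes torsion unramified: g x - x is again torsion and reduces to 0. *)
Lemma inertia_torsion g c x : inertia g -> away c -> act c x = 0 -> g x = x.
Proof.
move=> hg hc cx; apply/eqP; rewrite -subr_eq0; apply/eqP.
apply: (torsion_nil hc).
  by rewrite actBr -inertia_act // cx rmorph0 subr0.
apply/(int_closure_maxE v_pi v_complete v_finite Ks_alg p_charKs).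
by have [_] := hg; apply; apply: torsion_int cx.
Qed.

Lemma inertia_comp (g h : {rmorphism Ks -> Ks}) : inertia g -> inertia h ->
  inertia (g \o h).
Proof.
have iE := inertiaE v_pi v_complete v_finite Ks_alg p_charKs.
move=> /iE[[_ gK] gE] /iE[[_ hK'] hE]; apply/iE; split.
  by apply: galois_bijective => // k /=; rewrite hK' gK.
by move=> t ht /=; rewrite hE // gE.
Qed.

Lemma inertia_id : inertia (idfun : {rmorphism Ks -> Ks}).
Proof.
have iE := inertiaE v_pi v_complete v_finite Ks_alg p_charKs.
by apply/iE; split => //; apply: galois_bijective.
Qed.

Let lam0 : lam != 0.
Proof. by apply: contraNneq hlam => ->; apply: rpred0. Qed.

(* In terms of valuations: v(lam) = q^d v(x) < 0. *)
Lemma act_root_val c d x : away c -> size (D c) = d.+1 -> act c x = i lam ->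
  [/\ x != 0, m x^-1 &
      exists2 u, int_unit vK i u & i lam = u * x ^+ (q ^ d)].
Proof.
move=> hc sz cx.
have ld : (D c)`_d \notin vmax vK.
  by have [d' [sz' ld]] := dphi_degree D (away_neq0 hc); move: sz';
    rewrite sz => -[->].
have [l0 lV] := vring_unit (dphi_coef D c d) ld.
have x0 : x != 0.
  by apply: contra_neq lam0 => x0; apply: (fmorph_inj i);
    rewrite -cx x0 act0r rmorph0.
set w := x^-1.
have w0 : w != 0 by rewrite invr_eq0.
(* The equation D_c(x) = lam is divided by x^(q^d) and read as a polynomial in w = 1/x. *)
pose U := \sum_(k < d.+1) i (D c)`_k * w ^+ (q ^ d - q ^ k).
have lamE : i lam * w ^+ (q ^ d) = U.
  rewrite -cx /drinfeld_act /skew_eval sz mulr_suml; apply: eq_bigr => k _.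
  have le_k : (q ^ k <= q ^ d)%N by rewrite leq_exp2l // -ltnS ltn_ord.
  have -> : w ^+ (q ^ d) = w ^+ (q ^ k) * w ^+ (q ^ d - q ^ k).
    by rewrite -exprD subnKC.
  by rewrite mulrA -[_ * _ * w ^+ (q ^ k)]mulrA -exprMn divff // expr1n mulr1.
have [e he lamV] : exists2 e, e \in vring vK & lam^-1 = pi * e.
  apply/(vmaxP v_pi); rewrite inE /val_ge invr_eq0 (negPf lam0) dvalV -gtz0_ge1.
  by move: hlam; rewrite inE /val_ge (negPf lam0) oppr_gt0 -ltNge.
have wE : w ^+ (q ^ d) = i (pi * e) * U.
  by rewrite -lamE -lamV fmorphV mulKf // fmorph_eq0.
have lamVO : O (i (pi * e)).
  by apply/int_closureK; rewrite rpredM // (unif_vring v_pi).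
have wO : O w.
  pose P := 'X^(q ^ d) - i (pi * e) *: \sum_(k < d.+1) i (D c)`_k *: 'X^(q ^ d
    - q ^ k).
  have szS : (size (i (pi * e) *: \sum_(k < d.+1) i (D c)`_k *: 'X^(q ^ d - q
    ^ k))%R
      < (q ^ d).+1)%N.
    rewrite ltnS; apply: leq_trans (size_scale_leq _ _) _.
    apply: leq_trans (size_sum _ _ _) _; apply/bigmax_leqP => k _.
    apply: leq_trans (size_scale_leq _ _) _; rewrite size_polyXn.
    by rewrite ltn_subrL !q_gt0.
  apply: (@int_closure_root _ _ _ _ P).
  - by rewrite monicE lead_coefDl ?lead_coefXn // size_polyXn size_polyN.
  - rewrite rootE hornerD hornerN hornerZ hornerXn horner_sum wE subr_eq0.
    apply/eqP; congr (_ * _); apply: eq_bigr => k _.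
    by rewrite hornerZ hornerXn.
  - have coefX01 n k : O ('X^n : {poly Ks})`_k.
      by rewrite coefXn; case: (_ == _);
        [apply: int_closure1 | apply: int_closure0].
    move=> k; rewrite coefB coefZ coef_sum; apply: int_closureB => //.
    apply: int_closureM => //; elim/big_ind: _ => [||l _];
      first exact: int_closure0.
      exact: int_closureD.
    by rewrite coefZ; apply: int_closureM => //; apply: act_dom_int.
have UO : O U.
  rewrite /U; elim/big_ind: _ => [||l _]; first exact: int_closure0.
    exact: int_closureD.
  by apply: int_closureM; [apply: act_dom_int | apply: int_closureX].
have mw : m w.
  have [f _ qE] := card_pX p_char.
  split=> //; exists (f * d)%N; rewrite expnM -qE wE rmorphM mulrC !mulrA.
  have pi0 : i pi != 0 by rewrite fmorph_eq0 (unif_neq0 v_pi).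
  by rewrite mulVf // mul1r; apply: int_closureM => //; apply: int_closureK.
split=> //; exists U; last by rewrite -lamE /w exprVn divfK // expf_neq0.
(* The term k = d is the leading coefficient of [D c], a unit; every other term contains a positive
   power of [w]. *)
rewrite /U big_ord_recr /= subnn expr0 mulr1 addrC.
apply: (int_unitD v_pi v_complete Ks_alg p_charKs).
  by apply: int_unitK => //; apply: dval_unit => //; apply: dphi_coef.
elim/big_ind: _ => [||k _]; first exact: top_nilpotent0.
  exact: (top_nilpotentD p_charKs).
apply: top_nilpotentMl; first exact: act_dom_int.
have : (0 < q ^ d - q ^ k)%N by rewrite subn_gt0 ltn_exp2l // ltn_ord.
case: (q ^ d - q ^ k)%N => // n _; rewrite exprSr; apply: top_nilpotentMl => //.
exact: int_closureX.
Qed.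

(** For D_c(x) = lam with [c] away from the residual characteristic, this is the subgroup H of the
    overview. *)
Definition kummer_image (x : Ks) : set Ks := [set g x - x | g in inertia].

Section Level.
Variables (c : A) (x : Ks).
Hypotheses (hc : away c) (cx : act c x = i lam).

Lemma kummer_image_torsion y : kummer_image x y -> act c y = 0.
Proof.
move=> [g hg <-].
by rewrite actBr -inertia_act // cx (inertia_galois hg) subrr.
Qed.

Lemma kummer_image_fixed g y : inertia g -> kummer_image x y -> g y = y.
Proof. by move=> hg /kummer_image_torsion; apply: inertia_torsion. Qed.

Lemma kummer_image0 : kummer_image x 0.
Proof. by exists idfun; [apply: inertia_id | rewrite /= subrr]. Qed.

Lemma kummer_imageD y z :
  kummer_image x y -> kummer_image x z -> kummer_image x (y + z).
Proof.
move=> Hy Hz; have [g hg gE] := Hy; have [h hh hE] := Hz.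
exists (g \o h); first exact: inertia_comp.
rewrite /= -(subrK x (h x)) hE rmorphD (kummer_image_fixed hg Hz) -gE.
by ring.
Qed.

(** In characteristic p the opposite of [z] is (p-1) z, so closure under addition suffices. *)
Lemma kummer_imageB y z :
  kummer_image x y -> kummer_image x z -> kummer_image x (y - z).
Proof.
move=> Hy Hz; apply: kummer_imageD => //.
have Hn n : kummer_image x (z *+ n).
  elim: n => [|n IHn]; first by rewrite mulr0n; apply: kummer_image0.
  by rewrite mulrS; apply: kummer_imageD.
suff -> : - z = z *+ p.-1 by [].
apply/esym/eqP; rewrite -addr_eq0 -mulrSr prednK ?prime_gt0 ?(pcharf_prime
  p_charKs) //.
by rewrite -mulr_natr (pcharf0 p_charKs) mulr0.
Qed.

(* The product of the x - h, for h in the Kummer image H, is fixed by inertia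
   and so has the valuation of some element of K; comparing with lam, of
   valuation q^d v(x), bounds q^d / #H by - v(lam). *)
Lemma kummer_image_card d (H : seq Ks) : size (D c) = d.+1 -> uniq H ->
    (forall y, y \in H <-> kummer_image x y) ->
  (q ^ d <= `|vK lam| * size H)%N.
Proof.
move=> sz uH HP; have [x0 mx [u uu lamE]] := act_root_val hc sz cx.
pose z := \prod_(h <- H) (x - h).
have zU : unramified i p z.
  apply: (unramified_fixed v_pi v_complete v_finite hKs p_charK) => g hg.
  rewrite rmorph_prod /=.
  have gx : kummer_image x (g x - x) by exists g.
  (* Inertia fixes H pointwise, so [g] acts on the factors x - h by a translation of H. *)
  have pH : perm_eq H [seq h + (g x - x) | h <- H].
    have uH' : uniq [seq h + (g x - x) | h <- H].
      by rewrite map_inj_uniq // => a b /addIr.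
    have sub : {subset [seq h + (g x - x) | h <- H] <= H}.
      by move=> _ /mapP[h /HP hH ->]; apply/HP/kummer_imageD.
    rewrite perm_sym; apply: uniq_perm => //.
    by have [|_] := uniq_min_size uH' sub; rewrite ?size_map.
  rewrite (perm_big _ pH) big_map /= /z big_seq [RHS]big_seq.
  apply: eq_bigr => h /HP hH.
  rewrite rmorphB rmorphD rmorphB /= (kummer_image_fixed hg hH).
  have /(kummer_image_fixed hg) : kummer_image x (g x - x) by exists g.
  by rewrite rmorphB => ->; ring.
have [w wu zE] : exists2 w, int_unit vK i w & z = w * x ^+ size H.
  have hunit h : h \in H -> int_unit vK i ((x - h) / x).
    move=> /HP /kummer_image_torsion ch.
    rewrite mulrBl divff // -mulNr;
      apply: (int_unitD v_pi v_complete Ks_alg p_charKs).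
      exact: int_unit1.
    by apply: top_nilpotentMl => //; apply: int_closureN; apply: torsion_int ch.
  exists (\prod_(h <- H) ((x - h) / x)).
    rewrite big_seq; elim/big_ind: _ => //; first exact: int_unit1.
    exact: int_unitM.
  rewrite /z; elim: (H) => [|h r IHr]; first by rewrite !big_nil mulr1.
  by rewrite !big_cons /= IHr exprS mulrACA divfK.
have z0 : z != 0 by have [w0 _ _] := wu; rewrite zE mulf_neq0 // expf_neq0.
have [b b0 bu] := unramified_val v_pi v_complete v_finite hKs p_charK zU z0.
have ib0 : i b != 0 by rewrite fmorph_eq0.
have [u0 _ _] := uu; have [w0 _ _] := wu.
(* Numerator and denominator both equal x^(#H q^d) up to units, whence #H v(lam) = q^d v(b). *)
have [_ kO kV] : int_unit vK i (i (lam ^+ size H / b ^+ (q ^ d))).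
  have -> : i (lam ^+ size H / b ^+ (q ^ d)) =
      (u ^+ size H * w ^- (q ^ d)) * (z / i b) ^+ (q ^ d).
    rewrite rmorphM fmorphV !rmorphXn lamE exprMn exprMn zE exprMn -!exprM.
    rewrite [(size H * _)%N]mulnC exprVn.
    have wd0 := expf_neq0 (q ^ d) w0; have bd0 := expf_neq0 (q ^ d) ib0.
    by field; rewrite wd0 bd0.
  apply: int_unitM; last exact: int_unitX.
  by apply: int_unitM; [|apply: int_unitV]; apply: int_unitX.
have k0 : lam ^+ size H / b ^+ (q ^ d) != 0
  by rewrite mulf_neq0 ?invr_eq0 ?expf_neq0.
rewrite -fmorphV in kV.
have := dval_unit k0 (int_closure_vring v_pi kO) (int_closure_vring v_pi kV).
rewrite dvalM ?invr_eq0 ?expf_neq0 // dvalV !dvalX => /eqP.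
rewrite subr_eq0 -[vK lam *+ _]mulr_natr -[vK b *+ _]mulr_natr => /eqP vE.
have lam_lt0 : vK lam < 0.
  by move: hlam; rewrite inE /val_ge (negPf lam0) -ltNge.
have H0 : (0 < size H)%N.
  by case: (H) HP => // HP; have /HP := kummer_image0.
have /(congr1 absz) := vE; rewrite !abszM !natz !absz_nat => ->.
(* v(b) is a nonzero integer, because v(lam) < 0 and H is nonempty. *)
rewrite leq_pmull // absz_gt0; apply: contraTneq lam_lt0 => b00.
have : vK lam * (size H)%:R = 0 by rewrite vE b00 mul0r.
by move/eqP; rewrite mulf_eq0 natz eqz_nat (gtn_eqF H0) orbF => /eqP ->.
Qed.

End Level.
End KummerImage.

(** * Stabilization of the Kummer image *)

Lemma card_kernel_image (V : zmodType) (f : V -> V) (G I N : seq V) :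
    {morph f : x y / x - y} -> uniq G -> uniq I -> uniq N ->
    {in G &, forall x y, x - y \in G} -> {in G, forall x, f x \in I} ->
    {in I, forall y, exists2 x, x \in G & f x = y} ->
    (forall x, (x \in N) = (x \in G) && (f x == 0)) ->
  size G = (size I * size N)%N.
Proof.
move=> fB uG uI uN GB fI If Nf.
have /choice[s sP] : forall y, exists x, y \in I -> x \in G /\ f x = y.
  move=> y; case: (boolP (y \in I)) => [/If[x]|_]; last by exists 0.
  by exists x.
rewrite -(size_allpairs (fun y n => s y - n)).
have NG n : n \in N -> n \in G /\ f n = 0 by rewrite Nf => /andP[? /eqP].
apply/perm_size/uniq_perm => //.
  apply: allpairs_uniq =>
    //= -[y n] [y' n'] /allpairsP[[a b] [/= aI bN [-> ->]]].
  move=> /allpairsP[[a' b'] [/= a'I b'N [-> ->]]] E.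
  have [_ fb] := NG _ bN; have [_ fb'] := NG _ b'N.
  have [_ fa] := sP _ aI; have [_ fa'] := sP _ a'I.
  have aa' : a = a' by move/(congr1 f): E; rewrite !fB fa fa' fb fb' !subr0.
  by move: E; rewrite aa' => /addrI/oppr_inj ->.
move=> x; apply/idP/allpairsP => [xG|[[y n] [/= yI nN ->]]]; last first.
  by apply: GB; [apply: (sP _ yI).1 | apply: (NG _ nN).1].
have [sG fs] := sP _ (fI _ xG).
exists (f x, s (f x) - x); split=> /=;
  [exact: fI | | by rewrite opprB addrC subrK].
by rewrite Nf GB //= fB fs subrr eqxx.
Qed.

Section Stabilization.
Variables (Fq : finFieldType) (F K : fieldType).
Variables (vinf : dvaluation F) (vK : dvaluation K).
Hypothesis hK : local_field vK.
Variables (jK : {rmorphism Fq -> K}) (Ks : fieldType) (i : {rmorphism K -> Ks}).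
Hypothesis hKs : separable_closure i.
Variable D : drinfeld_module Fq vinf vK.
Variable lam : K.
Hypothesis hlam : lam \notin vring vK.
Variable p : nat.
Hypothesis p_char : p \in [pchar Fq].
Variable pi : K.
Hypothesis v_pi : vK pi = 1.

Local Notation q := #|Fq|.
Local Notation A := (regular_ring vinf).
Local Notation act := (drinfeld_act D i).
Local Notation inertia := (inertia_group i vK).
Local Notation away := (@away Fq F K vinf vK D).
Local Notation kummer_image := (@kummer_image K vK Ks i).

Let act0r := act0r D i jK p_char.
Let actDr := actDr D i jK p_char.
Let actBr := actBr D i jK p_char.
Let actM := actM D i jK p_char.
Let kimg0 := kummer_image0 hK jK hKs p_char v_pi.
Let kimgB := @kummer_imageB _ F K vinf vK hK jK Ks i hKs D lam p p_char pi v_pi.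
Let kimg_tors := @kummer_image_torsion _ F K vinf vK jK Ks i D lam p p_char.
Let tors_fixed := @inertia_torsion _ F K vinf vK hK jK Ks i hKs D p p_char pi
  v_pi.

(** Two roots differ by torsion, which inertia fixes; the Kummer cocycle is therefore independent of
    the root. *)
Lemma root_shift (g : {rmorphism Ks -> Ks}) c x x' : inertia g -> away c ->
  act c x = act c x' -> g x' - x' = g x - x.
Proof.
move=> hg hc cx; have : g (x' - x) = x' - x.
  by apply: tors_fixed hg hc _; rewrite actBr cx subrr.
move=> E; have -> : g x' - x' = (g x' - g x) + (g x - x) - (x' - x) by ring.
by rewrite -rmorphB E; ring.
Qed.

Lemma kummer_image_root c x x' y : away c -> act c x = act c x' ->
  kummer_image x y -> kummer_image x' y.
Proof. by move=> hc cx [g hg <-]; exists g => //; apply: root_shift cx. Qed.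

Lemma kummer_image_seq c x : away c -> act c x = i lam ->
  exists2 H : seq Ks, uniq H & forall y, y \in H <-> kummer_image x y.
Proof.
move=> hc cx; have [d [sz _]] := dphi_degree D (away_neq0 hc).
have [V [uV _ VP]] := act_kernel jK p_char hKs hc sz.
exists [seq y <- V | `[< kummer_image x y >]]; first exact: filter_uniq.
move=> y; rewrite mem_filter VP; split=> [/andP[/asboolP]//|Hy].
by apply/andP; split; [apply/asboolP | apply/eqP/(kimg_tors cx)].
Qed.

(** Multiplication by [b] maps D[bc] onto D[c] with kernel D[b]. *)
Lemma act_degreeM b c k l n : away b -> away c -> size (D b) = k.+1 ->
  size (D c) = l.+1 -> size (D (b * c)) = n.+1 -> (q ^ n = q ^ l * q ^ k)%N.
Proof.
move=> hb hc szb szc szbc; have hbc := awayM hb hc.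
have [Vb [uVb <- VbP]] := act_kernel jK p_char hKs hb szb.
have [Vc [uVc <- VcP]] := act_kernel jK p_char hKs hc szc.
have [V [uV <- VP]] := act_kernel jK p_char hKs hbc szbc.
apply: (card_kernel_image (f := act b)) => // [x y|x|y|x].
- by rewrite !VP actBr => /eqP -> /eqP ->; rewrite subrr.
- by rewrite VP VcP -actM mulrC.
- rewrite VcP => /eqP cy; have [x bx] := act_surj jK p_char hKs y hb.
  by exists x => //; rewrite VP mulrC actM bx cy.
- rewrite VbP VP mulrC actM; case: eqP => [->|]; rewrite ?act0r ?eqxx //.
  by rewrite andbF.
Qed.

(** Multiplication by [b] maps H onto H', with kernel N inside D[b]. As [y] is in D[b] but not in H,
    the sets N and N + y are disjoint in D[b], so N has index at least 2 there. *)
Lemma index_doubling b c x x' d e (H H' : seq Ks) y : away b -> away c ->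
    act (b * c) x = i lam -> act c x' = i lam ->
    size (D c) = d.+1 -> size (D (b * c)) = e.+1 -> uniq H -> uniq H' ->
    (forall y, y \in H <-> kummer_image x y) ->
    (forall y, y \in H' <-> kummer_image x' y) ->
    act b y = 0 -> ~ kummer_image x y ->
  exists2 n, size H = (size H' * n)%N & exists2 l, (q ^ e = q ^ d * l)%N & (2
    * n <= l)%N.
Proof.
move=> hb hc bcx cx' szc szbc uH uH' HP HP' by0 ny.
have hbc := awayM hb hc.
have [k [szb _]] := dphi_degree D (away_neq0 hb).
have [Vb [uVb szVb VbP]] := act_kernel jK p_char hKs hb szb.
pose N := [seq z <- H | act b z == 0].
have uN : uniq N by apply: filter_uniq.
have cbx : act c (act b x) = act c x' by rewrite -actM mulrC bcx cx'.
exists (size N).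
  apply: (card_kernel_image (f := act b)) => // [z w|z|z|z].
  - by move=> /HP Hz /HP Hw; apply/HP/(kimgB hbc bcx).
  - move=> /HP[g hg <-]; apply/HP'; apply: (kummer_image_root hc cbx).
    by exists g; rewrite // actBr -inertia_act.
  - move=> /HP' /(kummer_image_root hc (esym cbx)) [g hg <-].
    exists (g x - x); first by apply/HP; exists g.
    by rewrite actBr -inertia_act.
  - by rewrite mem_filter andbC.
exists (q ^ k)%N; first exact: act_degreeM szb szc szbc.
rewrite -szVb mul2n -addnn -{2}(size_map (fun z => z + y)) -size_cat.
apply: uniq_leq_size => [|z]; last first.
  rewrite mem_cat VbP mem_filter => /orP[/andP[]//|/mapP[w]].
  by rewrite mem_filter => /andP[/eqP bw _] ->; rewrite actDr bw by0 addr0.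
rewrite cat_uniq uN map_inj_uniq ?uN ?andbT => [|z w /addIr//].
apply/hasPn => _ /mapP[w + ->]; rewrite mem_filter => /andP[_ /HP Hw].
apply/negP; rewrite mem_filter => /andP[_ /HP Hwy]; apply: ny.
by rewrite -(addrK w y) addrC [y + w]addrC; rewrite addrC;
  apply: (kimgB hbc bcx).
Qed.

Lemma kummer_image_stable : exists2 c0, away c0 &
  forall b x y, away b -> act (b * c0) x = i lam -> act b y = 0 ->
    kummer_image x y.
Proof.
apply: contrapT => unstable.
have grow k : exists c d x H, [/\ away c, size (D c) = d.+1, act c x = i lam,
    uniq H /\ forall y, y \in H <-> kummer_image x y &
    (2 ^ k * size H <= q ^ d)%N].
  elim: k => [|k [c [d [x' [H' [hc szc cx' [uH' HP'] le_k]]]]]].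
    have a1 : away 1 := away1 D.
    have [d [sz _]] := dphi_degree D (away_neq0 a1).
    have e1 : act 1 (i lam) = i lam by apply: act1.
    have [H uH HP] := kummer_image_seq a1 e1.
    exists 1, d, (i lam), H; split=> //.
    have [V [uV <- VP]] := act_kernel jK p_char hKs a1 sz.
    rewrite mul1n; apply: uniq_leq_size => // y /HP Hy.
    by rewrite VP; apply/eqP/(kimg_tors e1 Hy).
  have [b [x [y [hb bcx by0 ny]]]] : exists b x y,
      [/\ away b, act (b * c) x = i lam, act b y = 0 & ~ kummer_image x y].
    apply: contrapT => none; apply: unstable; exists c => // b x y hb bcx by0.
    by apply: contrapT => ny; apply: none; exists b, x, y.
  have hbc := awayM hb hc.
  have [e [szbc _]] := dphi_degree D (away_neq0 hbc).
  have [H uH HP] := kummer_image_seq hbc bcx.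
  have [n nE [l lE le_n]] :=
    index_doubling hb hc bcx cx' szc szbc uH uH' HP HP' by0 ny.
  exists (b * c), e, x, H; split=> //.
  by rewrite nE lE expnSr mulnACA; apply: leq_mul.
(* With m = |v(lam)|, after m doublings 2^m > m contradicts the bound q^d <= m #H. *)
have [c [d [x [H [hc sz cx [uH HP] le_H]]]]] := grow `|vK lam|%N.
have H0 : (0 < size H)%N.
  by case: (H) HP => // HP; have /HP := kimg0 x.
have := kummer_image_card hK jK hKs hlam p_char v_pi hc cx sz uH HP.
by move=> /(leq_trans le_H); rewrite leq_pmul2r // leqNgt ltn_expl.
Qed.

(* The maps of I_K realizing the prescribed values at a single level determine
   a partial homomorphism on the field generated by the roots X b. *)
Lemma kummer_glue (c0 : A) (X tau : A -> Ks) (g0 : {rmorphism Ks -> Ks}) :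
    away c0 ->
    (forall b x y, away b -> act (b * c0) x = i lam -> act b y = 0 ->
       kummer_image x y) ->
    (forall b, away b -> act (b * c0) (X b) = i lam) ->
    (forall b, away b -> act (b * c0) (tau b) = 0) ->
    (forall b b', away b -> away b' -> act b' (tau (b * b')) = tau b) ->
    inertia g0 ->
    (forall b, away b -> act b (tau b) = act b (g0 (X b) - X b)) ->
  exists2 g, inertia g & forall b, away b -> g (X b) = X b + tau b.
Proof.
move=> hc0 stable Xlam tau_tors tau_comp hg0 tau_g0.
pose G b := [set g | inertia g /\ g (X b) = X b + tau b].
have G_ne b : away b -> exists g, G b g.
  move=> hb; have hbc := awayM hb hc0.
  have : act b (tau b - (g0 (X b) - X b)) = 0.
    by rewrite actBr tau_g0 // subrr.
  move=> /(stable _ _ _ hb (Xlam b hb)) [g hg gE].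
  (* [g] realizes the discrepancy between tau b and the cocycle of [g0]; this is torsion, hence
     fixed by [g0], so composition adds the two. *)
  exists (g0 \o g); split; first exact: (inertia_comp hK jK hKs p_char v_pi).
  have tE : act (b * c0) (tau b - (g0 (X b) - X b)) = 0.
    rewrite actBr tau_tors // (@kimg_tors (b * c0) (X b)) ?subrr //;
      first exact: Xlam.
    by exists g0.
  rewrite /= -(subrK (X b) (g (X b))) gE rmorphD (tors_fixed hg0 hbc tE).
  by ring.
have G_sub b b' : away b -> away b' -> G (b * b') `<=` G b.
  move=> hb hb' g [hg gE]; split=> //.
  have hbc := awayM hb hc0.
  have E : act (b * c0) (act b' (X (b * b'))) = act (b * c0) (X b).
    by rewrite -actM mulrAC !Xlam // awayM.
  have := root_shift hg hbc E;
    rewrite (inertia_act _ _ _ hg) // gE actDr tau_comp //.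
  by move=> E'; rewrite -(subrK (X b) (g (X b))) E'; ring.
(* The pairs on which all realizations at some level agree. Two levels are compared at their
   product, whose realizations work for both; nonemptiness makes [R] functional. *)
pose R := [set z : Ks * Ks | exists2 b, away b & forall g, G b g -> g z.1 =
  z.2].
have G_two b b' g : away b -> away b' -> G (b * b') g -> G b g /\ G b' g.
  by move=> hb hb' Gg; split; [apply: G_sub Gg | rewrite mulrC in Gg;
    apply: G_sub Gg].
have hR : partial_hom i R.
  split.
  - by move=> k; exists 1; [apply: away1 | move=> g [hg _];
    apply: (inertia_galois hg)].
  - move=> x x' y y' [b hb Hb] [b' hb' Hb']; exists (b * b');
    first exact: awayM.
    by move=> g /(G_two _ _ _ hb hb')[/Hb /= E /Hb' /= E'];
      rewrite /= rmorphB E E'.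
  - move=> x x' y y' [b hb Hb] [b' hb' Hb']; exists (b * b');
    first exact: awayM.
    by move=> g /(G_two _ _ _ hb hb')[/Hb /= E /Hb' /= E'];
      rewrite /= rmorphM E E'.
  - by move=> x' [b hb Hb]; have [g /Hb /= <-] := G_ne b hb; rewrite rmorph0.
have [g [hg gR]] := partial_hom_extend hKs hR.
have iE := inertiaE v_pi hK.1 hK.2 (separable_closure_algebraic hKs)
  (pchar_ext i jK p_char).
exists g; last by move=> b hb; apply: gR; exists b => // h [].
(* Every element of [G 1] is in inertia and fixes [t], so the glued map does too. *)
apply/iE; split=> // t ht; apply: gR; exists 1; first exact: away1.
by move=> h [/iE[_ +] _]; apply.
Qed.

End Stabilization.

(** * Levels and the Tate module *)

Section Levels.
Variables (Fq : finFieldType) (F K : fieldType).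
Variables (vinf : dvaluation F) (vK : dvaluation K).
Hypothesis hK : local_field vK.
Variables (jK : {rmorphism Fq -> K}) (Ks : fieldType) (i : {rmorphism K -> Ks}).
Hypothesis hKs : separable_closure i.
Variable D : drinfeld_module Fq vinf vK.
Variable lam : K.
Variable p : nat.
Hypothesis p_char : p \in [pchar Fq].
Variable pi : K.
Hypothesis v_pi : vK pi = 1.

Local Notation A := (regular_ring vinf).
Local Notation act := (drinfeld_act D i).
Local Notation inertia := (inertia_group i vK).
Local Notation away := (@away Fq F K vinf vK D).

Let actBr := actBr D i jK p_char.
Let actM := actM D i jK p_char.
Let tors_fixed := @inertia_torsion _ F K vinf vK hK jK Ks i hKs D p p_char pi
  v_pi.

Lemma level_away (n : level D) : exists2 c, level_set n c & away c.
Proof.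
apply: contrapT => none; apply: (level_not_sub (l := n)) => c nc.
by apply: contrapT => hc; apply: none; exists c => //; apply/negP.
Qed.

Lemma level_inv_mul (n : level D) c (x : level_inv n) : level_set n c ->
  exists y : A, val y = val c * val x.
Proof.
move=> nc; have h := set_mem (valP x) c nc.
by exists (RegularRing h).
Qed.

Lemma away_mulfK b c : away c -> val b = val (b * c) * (val c)^-1.
Proof.
by move=> /away_neq0 c0; rewrite -[val (b * c)]/(val b * val c) mulfK //.
Qed.

(** [n0] witnesses that the ideal generated by [c] is proper. *)
Lemma principal_level (c : A) (n0 : level D) : away c -> level_set n0 c ->
  exists2 n : level D, level_set n = [set a | exists b, a = b * c] &
    exists e : level_inv n, val e = (val c)^-1.
Proof.
move=> hc nc; set I := [set a | _].
have I0 : I 0 by exists 0; rewrite mul0r.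
have ID a b : I a -> I b -> I (a + b).
  by move=> [a' ->] [b' ->]; exists (a' + b'); rewrite mulrDl.
have IM a b : I b -> I (a * b) by move=> [b' ->]; exists (a * b');
  rewrite mulrA.
have I_proper : I <> setT.
  move=> IT; have [b bE] : I 1 by rewrite IT.
  apply: (level_proper (l := n0)); rewrite -subTset => a _.
  by rewrite -[a]mulr1 bE; do 2!apply: levelM.
have I_sub : ~ (I `<=` residual_char D).
  have Ic : I c by exists 1; rewrite mul1r.
  by move=> /(_ c Ic); apply/negP.
exists (Level I0 ID IM I_proper I_sub) => //.
have eP : level_inv (Level I0 ID IM I_proper I_sub) (val c)^-1.
  by move=> _ [b ->]; rewrite -(away_mulfK b hc); apply: valP.
by exists (SigSub (mem_set eP)).
Qed.

Lemma torsion_linear (n : level D) (h : torsion i n) (a : A) (x z : level_inv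
  n) :
  val z = val a * val x -> val h z = act a (val h x).
Proof. by have [[_ +] _] := set_mem (valP h); apply. Qed.

Lemma torsion_vanish (n : level D) (h : torsion i n) (x : level_inv n) :
  val x \in regular vinf -> val h x = 0.
Proof. by have [_ +] := set_mem (valP h); apply. Qed.

(* Here [tau] is the value of [t] at 1/c. *)
Lemma tate_root (t : @tate_module Fq F K vinf vK D Ks i) (c : A) (n0 : level
  D) :
    away c -> level_set n0 c -> exists2 tau, act c tau = 0 &
  forall (n : level D) (x : level_inv n) (y : A), level_set n c ->
    val y = val c * val x -> val (val t n) x = act y tau.
Proof.
move=> hc nc; have [n' n'E [e eE]] := principal_level hc nc.
have c0 : val c != 0
  by rewrite -[0]/(val (0 : A)) (inj_eq val_inj) (away_neq0 hc).
have oneP : level_inv n' 1 by move=> a _; rewrite mulr1; apply: valP.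
pose one : level_inv n' := SigSub (mem_set oneP).
exists (val (val t n') e) => [|n x y nc' yE].
  rewrite -(torsion_linear _ (z := one)) /=; last by rewrite eE divff.
  by apply: torsion_vanish; apply: rpred1.
have sub : level_set n' `<=` level_set n by rewrite n'E => _ [b ->];
  apply: levelM.
have xP : level_inv n' (val x) by move=> a /sub; apply: set_mem (valP x) a.
pose x' : level_inv n' := SigSub (mem_set xP).
rewrite -(set_mem (valP t) n' n sub x' x) //; apply: torsion_linear.
by rewrite yE eE /= mulrAC divff // mul1r.
Qed.

(** Both sides equal f(cx), as cx lies in A. Hence two choices of [f] differ by [c]-torsion, which
    inertia fixes. *)
Lemma linear_scale (n : level D) (f : level_inv n -> Ks) (c y : A) (x :
  level_inv n) :
    linear_maps i f -> (forall x : level_inv n, val x = 1 -> f x = i lam) ->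
    val y = val c * val x -> act c (f x) = act y (i lam).
Proof.
move=> [_ fM] f1 yE.
have oneP : level_inv n 1 by move=> a _; rewrite mulr1; apply: valP.
have yP : level_inv n (val y) by move=> a _; apply: rpredM; apply: valP.
rewrite -(f1 (SigSub (mem_set oneP))) //.
rewrite -(fM y _ (SigSub (mem_set yP))) /= ?mulr1 //.
by rewrite -(fM c x (SigSub (mem_set yP))).
Qed.

(** The linear map sending 1/c to [X] computes the pairing, and any other choice gives the same
    result. *)
Lemma kummer_root (g : {rmorphism Ks -> Ks}) (n : level D) (c : A) X :
    inertia g -> away c -> level_set n c -> act c X = i lam ->
  forall (x : level_inv n) (y : A), val y = val c * val x ->
    val (kummer i n (i lam) g) x = act y (g X - X).
Proof.
move=> hg hc nc cX.
have /choice[Y YE] : forall x : level_inv n, exists y : A, val y = val c * val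
  x.
  by move=> x; apply: level_inv_mul.
pose f x := act (Y x) X.
have f_lin : linear_maps i f.
  split=> [x y z E|a x z E]; rewrite /f.
    rewrite -actD; congr (act _ X); apply: val_inj.
    by rewrite YE E mulrDr -!YE.
  rewrite -actM; congr (act _ X); apply: val_inj.
  by rewrite YE E mulrCA -YE.
have f1 x : val x = 1 -> f x = i lam.
  move=> E; rewrite -cX /f; congr (act _ X); apply: val_inj.
  by rewrite YE E mulr1.
have gact a x : g (act a x) = act a (g x) by apply: inertia_act.
have gfE x : g (f x) - f x = act (Y x) (g X - X) by rewrite gact actBr.
have h_tors : torsion_maps i (fun x => g (f x) - f x).
  have [f_add f_mul] := f_lin; split; first split.
  - by move=> x y z E; rewrite (f_add x y z E) rmorphD; ring.
  - by move=> a x z E; rewrite (f_mul a x z E) gact actBr.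
  - move=> x hx; have cx : Y x = RegularRing hx * c.
      by apply: val_inj; rewrite YE mulrC.
    rewrite /f cx actM cX gact; apply/eqP; rewrite subr_eq0.
    by rewrite (inertia_galois hg).
pose h : torsion i n := SigSub (mem_set h_tors).
have hP : kummer_rel (i lam) g h by exists f.
have uniq_h (h' : torsion i n) : kummer_rel (i lam) g h' -> forall x, val h' x
  = val h x.
  move=> [f' [f'_lin f'1 f'E]] x; rewrite f'E /=.
  have : g (f' x - f x) = f' x - f x.
    apply: (tors_fixed hg hc); rewrite actBr.
    by rewrite (linear_scale f'_lin f'1 (YE x)) (linear_scale f_lin f1 (YE x))
      subrr.
  move=> E; have -> : g (f' x) - f' x = g (f' x) - g (f x) + g (f x) - f' x by
    ring.
  by rewrite -rmorphB E; ring.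
move=> x y yE; rewrite /kummer.
have hK' := @xgetPex _ (torsion0 i n) _ (ex_intro (fun h =>
  kummer_rel (i lam) g h) h hP).
rewrite (uniq_h _ hK') /= gfE; congr (act _ _); apply: val_inj.
by rewrite YE.
Qed.

(** Components are compatible because one [c] in the smaller ideal and one root [X] compute both. *)
Lemma kummer_adE (g : {rmorphism Ks -> Ks}) n : inertia g ->
  val (kummer_ad D i (i lam) g) n = kummer i n (i lam) g.
Proof.
move=> hg.
have tP : @tate_module Fq F K vinf vK D Ks i (fun n => kummer i n (i lam) g).
  move=> n1 n2 sub x y xy; have [c nc hc] := level_away n1.
  have [X cX] := act_surj jK p_char hKs (i lam) hc.
  have [z zE] := level_inv_mul x nc.
  rewrite (kummer_root hg hc nc cX zE).
  by rewrite (kummer_root hg hc (sub _ nc) cX (y := z)) // zE xy.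
rewrite /kummer_ad; have := @xgetPex _ (tate0 D i)
  [set t : @tate_module Fq F K vinf vK D Ks i | forall n, val t n = kummer i n
    (i lam) g].
by apply; exists (SigSub (mem_set tP)).
Qed.

End Levels.

(** * The topology of the Tate module and the open image *)

Lemma open_tate_component (Fq : finFieldType) (F K : fieldType)
    (vinf : dvaluation F) (vK : dvaluation K) (D : drinfeld_module Fq vinf vK)
    (Ks : fieldType) (i : {rmorphism K -> Ks}) (n : level D) (h : torsion i n) :
  open [set t : @tate_module Fq F K vinf vK D Ks i | val t n = h].
Proof.
pose T (n : level D) : topologicalType := discrete_topology (torsion i n).
pose f (t : @tate_module Fq F K vinf vK D Ks i) : T n := val t n.
suff f_cont : continuous f.
  by apply: (@open_comp _ _ f [set h]) => [t _|];
    [apply: f_cont | apply: discrete_open].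
move=> t; apply: (@continuous_comp _ (prod_topology T) _ set_val (@proj _ T n)).
  exact: initial_continuous.
have /cvg_sup/(_ n) h_n : set_val t --> (set_val t : prod_topology T).
  exact: cvg_id.
move=> A nA; apply: h_n.
exact: (@initial_continuous _ _ (fun s : prod_topology T =>
  s n) (set_val t) A nA).
Qed.

Theorem theorem3p8 (Fq : finFieldType)
    (K : fieldType) (vK : dvaluation K) (hK : local_field vK)
    (jK : {rmorphism Fq -> K})
    (Ks : fieldType) (i : {rmorphism K -> Ks}) (hKs : separable_closure i)
    (F : fieldExtType {fraction {poly Fq}}) (vinf : dvaluation F)
    (D : drinfeld_module Fq vinf vK)
    (lam : K) (hlam : lam \notin vring vK) :
  open [set kummer_ad D i (i lam) g | g in inertia_group i vK].
Proof.
have [p _ p_char] := finPcharP Fq; have [pi v_pi] := dval_normalized vK.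
rewrite openE => _ [g0 hg0 <-].
have adE := @kummer_adE _ F K vinf vK hK jK Ks i hKs D lam p p_char pi v_pi.
(* Without levels the Tate module would be a single point, attained by [g0]. *)
have [[m0]|no_level] := pselect (exists n : level D, True); last first.
  apply: filterS (filterT) => t _; exists g0 => //.
  by apply: val_inj; apply: functional_extensionality_dep => n;
    case: no_level; exists n.
move=> _.
have [c1 m0c1 hc1] := level_away m0.
have [c2 hc2 stable2] := kummer_image_stable hK jK hKs D hlam p_char v_pi.
(* The factor [c2] gives stability, inherited by its multiples; [c1] in [m0] makes every multiple of
   [c0] generate a proper ideal. *)
pose c0 := c1 * c2.
have hc0 : away D c0 by apply: awayM.
have m0c0 b : level_set m0 (b * c0).
  by rewrite /c0 mulrCA mulrC; apply: levelM.
have stable b x y : away D b -> drinfeld_act D i (b * c0) x = i lam ->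
    drinfeld_act D i b y = 0 -> kummer_image vK i x y.
  move=> hb bx by0; apply: (stable2 (b * c1)); first exact: awayM.
    by rewrite -mulrA.
  by rewrite mulrC (actM D i jK p_char) by0 (act0r D i jK p_char).
have m0c : level_set m0 c0 by rewrite -[c0]mul1r.
have valM (b c : regular_ring vinf) (hc : away D c) := away_mulfK b hc.
have [n0 n0E [e0 e0E]] := principal_level hc0 m0c.
have n0c b : level_set n0 (b * c0) by rewrite n0E; exists b.
have t0_open := @open_tate_component _ _ _ _ _ _ _ _ n0
  (val (kummer_ad D i (i lam) g0) n0).
apply: (filterS _ (open_nbhs_nbhs (conj t0_open (erefl _)))) => t tn0.
have {}tn0 : val t n0 = val (kummer_ad D i (i lam) g0) n0 := tn0.
(* tau b is the value of [t] at 1/(b c0), and X b below is a division point of [lam] at the same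
   level; the value 0 for other [b] is a dummy. *)
have /choice[tau tauP] : forall b, exists tau, away D b ->
    drinfeld_act D i (b * c0) tau = 0 /\
    forall (n : level D) (x : level_inv n) y, level_set n (b * c0) ->
      val y = val (b * c0) * val x -> val (val t n) x = drinfeld_act D i y tau.
  move=> b; case: (boolP (away D b)) => hb; last by exists 0.
  have [tau ? ?] := tate_root t (awayM hb hc0) (m0c0 b).
  by exists tau.
have /choice[X XP] : forall b, exists X, away D b ->
    drinfeld_act D i (b * c0) X = i lam.
  move=> b; case: (boolP (away D b)) => hb; last by exists 0.
  by have [X] := act_surj jK p_char hKs (i lam) (awayM hb hc0); exists X.
have [g hg gX] : exists2 g, inertia_group i vK g &
    forall b, away D b -> g (X b) = X b + tau b.
  apply: (kummer_glue hK jK hKs p_char v_pi hc0 stable XP _ _ hg0).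
  - by move=> b /tauP[].
  - move=> b b' hb hb'; have hbc := awayM hb hc0.
    (* Compatibility comes from evaluating [t] at 1/(b c0) = b'/(b b' c0) in two ways. *)
    have [n nE [e eE]] := principal_level hbc (m0c0 b).
    have nb : level_set n (b * c0) by rewrite nE; exists 1; rewrite mul1r.
    have nbb : level_set n (b * b' * c0) by rewrite nE; exists b';
      rewrite mulrA [b' * b]mulrC.
    have e1 : val (1 : regular_ring vinf) = val (b * c0) * val e.
      by rewrite eE (valM 1 _ hbc) mul1r.
    have e2 : val b' = val (b * b' * c0) * val e.
      by rewrite eE (valM b' _ hbc) mulrA [b' * b]mulrC.
    have [_ /(_ n e 1 nb e1)] := tauP b hb.
    have [_ /(_ n e b' nbb e2) ->] := tauP _ (awayM hb hb').
    by rewrite act1.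
  (* After multiplication by [b] both sides are values at 1/c0, where [t] agrees with the pairing of
     [g0]. *)
  - move=> b hb; have bE : val b = val (b * c0) * val e0 by rewrite e0E -valM.
    have [_ /(_ n0 e0 b (n0c b) bE) <-] := tauP b hb.
    rewrite tn0 adE //.
    exact: (kummer_root hK jK hKs p_char v_pi hg0 (awayM hb hc0) (n0c b) (XP b
      hb) bE).
exists g => //; apply: val_inj; apply: functional_extensionality_dep => n.
rewrite adE //; apply: val_inj; apply/funext => x.
(* Any level contains some b c0 with [b] away from the residual characteristic, so the values tau b
   determine [t] there. *)
have [b nb hb] := level_away n.
have nbc : level_set n (b * c0) by rewrite mulrC; apply: levelM.
have [y yE] := level_inv_mul x nbc.
rewrite (kummer_root hK jK hKs p_char v_pi hg (awayM hb hc0) nbc (XP b hb) yE).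
have [_ /(_ n x y nbc yE) ->] := tauP b hb.
by rewrite gX // addrAC subrr add0r.
Qed.
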